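(* For each $n \geq 0$ let $G_n$ be a finite simple graph which is either a quasi-threshold graph or is co-chromatic with some quasi-threshold graph. Let $f(n)$ be the number of vertices of $G_n$ and let $g(n) = \chi(G_n)/f(n)$, where $\chi(G_n)$ is the chromatic number of $G_n$. If $f(n) \to \infty$ and $g(n) \to 0$ as $n \to \infty$, then the Stirling sequence $\left({G_n \brace k}\right)_{k \in \mathbb{Z}}$ is asymptotically normal.
   Context: All graphs are simple, finite and loopless. An independent set in a graph is a set of vertices no two of which are adjacent. For a graph $G=(V,E)$ and integer $k$, ${G \brace k}$ denotes the number of partitions of $V$ into exactly $k$ non-empty independent sets (the graph Stirling number); the sequence $\left({G \brace k}\right)_{k\in\mathbb{Z}}$ is the Stirling sequence of $G$. Quasi-threshold graphs are defined inductively: $K_1$ is quasi-threshold; if $G$ is quasi-threshold then so is $G + K_1$, the graph obtained from $G$ by adding a new vertex adjacent to all vertices of $G$; if $G_1, G_2$ are quasi-threshold then so is their disjoint union $G_1 \cup G_2$. Two graphs $G,H$ are co-chromatic if their chromatic polynomials are identical, $\chi_G(x) \equiv \chi_H(x)$. Asymptotic normality: given for each $n$ a sequence $(a_{n,k})_{k\in\mathbb{Z}}$ of non-negative reals with $0<\sum_k a_{n,k}<\infty$, let $X_n$ be the integer-valued random variable with $\Pr(X_n=k)=a_{n,k}/\sum_j a_{n,j}$, with mean $\mu_n$ and standard deviation $\sigma_n$. The sequence is asymptotically normal if $\Pr\left((X_n-\mu_n)/\sigma_n \leq x\right) \to \Pr(Z\leq x)$ as $n\to\infty$, uniformly in $x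 \in \mathbb{R}$, where $Z$ is a standard normal random variable. *)

(* Defs.v *)
From HB Require Import structures.
From mathcomp Require Import all_boot all_order all_algebra.
From mathcomp Require Import boolp.
Set Implicit Arguments.
Unset Strict Implicit.
Unset Printing Implicit Defensive.
Import Order.TTheory GRing.Theory Num.Theory.
Local Open Scope ring_scope.

Record sgraph := SGraph {
  vertex :> finType;
  adj : rel vertex;
  adj_sym : symmetric adj;
  adj_irr : irreflexive adj }.

Definition graph_iso (G H : sgraph) : Prop :=
  exists2 f : G -> H, bijective f & forall x y, adj (f x) (f y) = adj x y.

Definition K1_adj : rel unit := fun _ _ => false.

Fact K1_sym : symmetric K1_adj. Proof. by []. Qed.
Fact K1_irr : irreflexive K1_adj. Proof. by []. Qed.

Definition K1 : sgraph := SGraph K1_sym K1_irr.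

Section Constructions.
Variables G H : sgraph.

(* [None] is the new vertex. *)
Definition cone_adj : rel (option G) := fun u v =>
  match u, v with
  | Some x, Some y => adj x y
  | None, None => false
  | _, _ => true
  end.

Fact cone_sym : symmetric cone_adj.
Proof. by move=> [x|] [y|] //=; exact: adj_sym. Qed.
Fact cone_irr : irreflexive cone_adj.
Proof. by move=> [x|] //=; exact: adj_irr. Qed.

Definition add_dominating : sgraph := SGraph cone_sym cone_irr.

Definition union_adj : rel (G + H)%type := fun u v =>
  match u, v with
  | inl x, inl y => adj x y
  | inr x, inr y => adj x y
  | _, _ => false
  end.

Fact union_sym : symmetric union_adj.
Proof. by move=> [x|x] [y|y] //=; exact: adj_sym. Qed.
Fact union_irr : irreflexive union_adj.
Proof. by move=> [x|x] //=; exact: adj_irr. Qed.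

Definition disjoint_union : sgraph := SGraph union_sym union_irr.

End Constructions.

(* [qt_iso] expresses that graphs are considered up to isomorphism: the other
   rules only produce graphs on particular vertex types. *)
Inductive quasi_threshold : sgraph -> Prop :=
| qt_K1 : quasi_threshold K1
| qt_add_dominating (G : sgraph) :
    quasi_threshold G -> quasi_threshold (add_dominating G)
| qt_disjoint_union (G H : sgraph) :
    quasi_threshold G -> quasi_threshold H ->
    quasi_threshold (disjoint_union G H)
| qt_iso (G H : sgraph) :
    graph_iso G H -> quasi_threshold G -> quasi_threshold H.

Definition independent (G : sgraph) (A : {set G}) : bool :=
  [forall x in A, forall y in A, ~~ adj x y].

Definition indep_partition (G : sgraph) (P : {set {set G}}) : bool :=
  partition P [set: G] && [forall A in P, independent A].

Definition graph_stirling (G : sgraph) (k : int) : nat :=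
  #|[set P : {set {set G}} | indep_partition P & #|P|%:Z == k]|.

Definition proper_coloring (G : sgraph) (q : nat) (c : {ffun G -> 'I_q}) :
    bool :=
  [forall x, forall y, adj x y ==> (c x != c y)].

Definition num_colorings (G : sgraph) (q : nat) : nat :=
  #|[set c : {ffun G -> 'I_q} | proper_coloring c]|.

Definition colorable (G : sgraph) (q : nat) : bool :=
  [exists c : {ffun G -> 'I_q}, proper_coloring c].

Lemma colorable_card (G : sgraph) : exists q, colorable G q.
Proof.
exists #|G|; apply/existsP; exists [ffun x => enum_rank x].
apply/forallP => x; apply/forallP => y; apply/implyP => xy.
rewrite !ffunE (inj_eq enum_rank_inj); apply/eqP => exy.
by rewrite exy adj_irr in xy.
Qed.

Definition chromatic_number (G : sgraph) : nat := ex_minn (colorable_card G).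

Definition is_chromatic_poly (G : sgraph) (p : {poly int}) : Prop :=
  forall q : nat, p.[q%:R] = (num_colorings G q)%:R.

Lemma is_chromatic_poly_inj (G : sgraph) (p p' : {poly int}) :
  is_chromatic_poly G p -> is_chromatic_poly G p' -> p = p'.
Proof.
move=> hp hp'; apply/eqP; rewrite -subr_eq0; apply/negPn/negP => nz.
pose rs := [seq (i%:R : int) | i <- iota 0 (size (p - p'))].
have := max_poly_roots nz (rs := rs).
rewrite size_map size_iota ltnn => H; suff: false by []; apply: H.
  apply/allP => _ /mapP[i _ ->].
  by rewrite rootE hornerD hornerN hp hp' subrr.
rewrite map_inj_uniq ?iota_uniq // => i j /eqP.
by rewrite eqr_nat => /eqP.
Qed.

Section ChromaticPolyExists.
Variables (G : sgraph) (q : nat).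

Definition color_classes (c : {ffun G -> 'I_q}) : {set {set G}} :=
  preim_partition c [set: G].

Lemma color_classes_indep (c : {ffun G -> 'I_q}) :
  proper_coloring c = indep_partition (color_classes c).
Proof.
rewrite /indep_partition preim_partitionP /=.
apply/idP/idP => [/forallP cP | /forallP cP].
  apply/forallP => A; apply/implyP => /imsetP[z _ ->].
  apply/forallP => x; apply/implyP; rewrite !inE /= => /eqP zx.
  apply/forallP => y; apply/implyP; rewrite !inE /= => /eqP zy.
  apply/negP => xy; have /forallP/(_ y) := cP x.
  by rewrite xy -zx -zy eqxx.
apply/forallP => x; apply/forallP => y; apply/implyP => xy.
apply/negP => /eqP cxy.
have /implyP := cP (pblock (color_classes c) x).
have eqR : {in [set: G] & &, equivalence_rel [rel x y | c x == c y]}.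
  by move=> u v w _ _ _ /=; split=> // /eqP ->.
have xin : x \in pblock (color_classes c) x.
  by rewrite (pblock_equivalence_partition eqR) ?inE /=.
have yin : y \in pblock (color_classes c) x.
  by rewrite (pblock_equivalence_partition eqR) ?inE //= cxy.
have cov : cover (color_classes c) = [set: G].
  exact: cover_partition (preim_partitionP c [set: G]).
rewrite pblock_mem ?cov ?inE // => /(_ isT) /forallP/(_ x).
by rewrite xin /= => /forallP/(_ y); rewrite yin /= xy.
Qed.

Lemma card_color_classes (P : {set {set G}}) : partition P [set: G] ->
  #|[set c : {ffun G -> 'I_q} | color_classes c == P]| = q ^_ #|P|.
Proof.
move=> Ppart.
pose D := {A : {set G} | A \in P}.
have cov x : x \in cover P by rewrite (cover_partition Ppart) inE.
have tI : trivIset P by case/and3P: Ppart.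
have nz : set0 \notin P by case/and3P: Ppart.
pose blk (x : G) : D := exist _ (pblock P x) (pblock_mem (cov x)).
have blk_surj A : exists x, blk x = A.
  case: A => A AP; have /set0Pn[x xA] : A != set0.
    by apply: contra nz => /eqP <-.
  by exists x; apply/val_inj; rewrite /= (def_pblock tI AP xA).
have blkE x y : (blk x == blk y) = (y \in pblock P x).
  by rewrite -val_eqE /= eq_pblock.
pose lift_col (h : {ffun D -> 'I_q}) : {ffun G -> 'I_q} := [ffun x => h (blk x)].
have lift_inj : injective lift_col.
  move=> h h' /ffunP e; apply/ffunP => A; have [x <-] := blk_surj A.
  by have := e x; rewrite !ffunE.
have <- : #|[set h : {ffun D -> 'I_q} | injectiveb h]| = q ^_ #|P|.
  by rewrite card_inj_ffuns card_ord card_sig.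
rewrite -(card_imset _ lift_inj); congr #|pred_of_set _|.
have classesE c : (color_classes c == P) =
    [forall x, forall y, (c x == c y) == (blk x == blk y)].
  have eqR : {in [set: G] & &, equivalence_rel [rel x y | c x == c y]}.
    by move=> u v w _ _ _ /=; split=> // /eqP ->.
  apply/eqP/idP => [e | /forallP H].
    apply/forallP => x; apply/forallP => y; rewrite blkE -e.
    by rewrite (pblock_equivalence_partition eqR) ?inE.
  rewrite -(equivalence_partition_pblock Ppart) /color_classes /preim_partition.
  apply: eq_in_imset => x _; apply/setP => y; rewrite !inE /=.
  by have /forallP/(_ y)/eqP -> := H x; rewrite blkE.
apply/setP => c; rewrite inE classesE; apply/idP/imsetP => [/forallP H | [h]].
  have H' x y : (c x == c y) = (blk x == blk y).
    by have /forallP/(_ y)/eqP := H x.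
  pose r A := sval (cid (blk_surj A)).
  have rK A : blk (r A) = A by rewrite /r; case: cid.
  exists [ffun A => c (r A)].
    rewrite inE; apply/injectiveP => A B; rewrite !ffunE => /eqP.
    by rewrite H' !rK => /eqP.
  by apply/ffunP => x; rewrite !ffunE; apply/eqP; rewrite H' rK.
rewrite inE => /injectiveP hinj ->.
apply/forallP => x; apply/forallP => y; rewrite !ffunE.
by rewrite (inj_eq hinj).
Qed.

Lemma num_coloringsE :
  num_colorings G q =
  (\sum_(P : {set {set G}} | indep_partition P) q ^_ #|P|)%N.
Proof.
rewrite /num_colorings -sum1_card.
rewrite (partition_big color_classes (@indep_partition G)) /=; last first.
  by move=> c; rewrite inE color_classes_indep.
apply: eq_bigr => P Pind; have /andP[Ppart _] := Pind.
rewrite -card_color_classes // -sum1_card; apply: eq_bigl => c.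
rewrite !inE color_classes_indep; apply: andb_idl.
by move/eqP ->.
Qed.

End ChromaticPolyExists.

Lemma chromatic_poly_exists (G : sgraph) : exists p, is_chromatic_poly G p.
Proof.
exists (\sum_(P : {set {set G}} | indep_partition P)
          \prod_(i < #|P|) ('X - (i%:R)%:P)) => q.
rewrite num_coloringsE natr_sum horner_sum; apply: eq_bigr => P _.
rewrite horner_prod; elim: #|P| => [|m IH]; first by rewrite big_ord0 ffactn0.
rewrite big_ord_recr /= IH ffactnSr natrM !hornerE.
have [mq|qm] := leqP m q; first by rewrite natrB.
by rewrite ffact_small // !mul0r.
Qed.

Definition chromatic_poly (G : sgraph) : {poly int} :=
  sval (cid (chromatic_poly_exists G)).

Lemma chromatic_polyP (G : sgraph) : is_chromatic_poly G (chromatic_poly G).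
Proof. by rewrite /chromatic_poly; case: cid. Qed.

Definition cochromatic (G H : sgraph) : Prop :=
  chromatic_poly G = chromatic_poly H.

(* Imported only here because [classical_sets] shadows [finset] names such as
   [partition] and [cover]. *)
From mathcomp Require Import all_classical all_reals all_analysis.
Import numFieldNormedType.Exports.
Local Open Scope classical_set_scope.
Local Open Scope ring_scope.

HB.instance Definition _ := isPointed.Build int 0.

HB.instance Definition _ := @isMeasurable.Build default_measure_display
  int discrete_measurable discrete_measurable0
  discrete_measurableC discrete_measurableU.

(* The random variable X, on the probability space (int, law a) below. *)
Definition int_rv {R : realType} (k : int) : R := k%:~R.

Fact measurable_int_rv {R : realType} : measurable_fun [set: int] (@int_rv R).
Proof. by []. Qed.

HB.instance Definition _ (R : realType) := isMeasurableFun.Build _ _ _ _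
  (@int_rv R) measurable_int_rv.

Section WeightMeasure.
Context {R : realType}.
Variable a : int -> {nonneg R}.

Definition weight_measure (A : set int) : \bar R :=
  (\esum_(k in A) ((a k)%:num)%:E)%E.

Let weight_measure0 : weight_measure set0 = 0%E.
Proof. by rewrite /weight_measure esum_set0. Qed.

Let weight_measure_ge0 A : (0 <= weight_measure A)%E.
Proof. by apply: esum_ge0 => k _; rewrite lee_fin. Qed.

Let weight_measure_sigma_additive : semi_sigma_additive weight_measure.
Proof.
move=> F _ tF _; rewrite /weight_measure.
have -> : (\esum_(k in \bigcup_n F n) ((a k)%:num)%:E)%E =
    (\sum_(0 <= i <oo) weight_measure (F i))%E.
  by rewrite nneseries_sum_bigcup // => k; rewrite lee_fin.
by apply: is_cvg_nneseries => n _ _; exact: weight_measure_ge0.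
Qed.

HB.instance Definition _ := isMeasure.Build _ _ _ weight_measure
  weight_measure0 weight_measure_ge0 weight_measure_sigma_additive.

End WeightMeasure.

Section Law.
Context {R : realType}.
Variable a : int -> {nonneg R}.

(* The law of X: P(X = k) = a_k / sum_j a_j, provided the sum is positive and
   finite ([mnormalize] falls back to the Dirac measure otherwise). *)
Definition law : probability int R := mnormalize (weight_measure a) (dirac (0 : int)).

Definition mean : R := fine 'E_law[int_rv].
Definition stddev : R := Num.sqrt (fine 'V_law[int_rv]).

(* If [stddev = 0] the quotient is 0. *)
Definition standardized_cdf (x : R) : R :=
  fine (law [set k | (int_rv k - mean) / stddev <= x]).

End Law.

Definition std_normal_cdf {R : realType} (x : R) : R :=
  fine (normal_prob 0 1 `]-oo, x]).

(* The second conjunct says that the means and variances exist. *)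
Definition asymptotically_normal {R : realType} (a : nat -> int -> {nonneg R}) :
    Prop :=
  [/\ forall n, (0 < \esum_(k in [set: int]) ((a n k)%:num)%:E < +oo)%E,
      forall n, int_rv \in Lfun (law (a n)) 2%:E
    & {uniform, (fun n => standardized_cdf (a n)) @ \oo --> std_normal_cdf}].

Definition stirling_sequence (R : realType) (G : sgraph) (k : int) :
    {nonneg R} := ((graph_stirling G k)%:R)%:nng.

(* Main.v *)
Require Import Defs.
From HB Require Import structures.
From mathcomp Require Import all_boot all_order all_algebra.
From mathcomp Require Import polyrcf ring lra zify.
Set Implicit Arguments.
Unset Strict Implicit.
Unset Printing Implicit Defensive.
Import Order.TTheory GRing.Theory Num.Theory.
Local Open Scope ring_scope.

(* The chromatic polynomial of a quasi-threshold graph is a product of factors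
   [q - c], where the [c] are the depths of the vertices of a rooted forest, so
   that exactly the numbers below the chromatic number [chi] occur as roots.
   Multiplication by [q - c] acts on the generating polynomial [S] of the Stirling
   sequence as [S |-> X S + X S' - c S]; starting from [X^chi], this preserves
   real-rootedness, and the normalized Stirling sequence is the law of a sum [X]
   of independent Bernoulli variables.

   The weights [w q = num_colorings q / q`!] dominate the Stirling numbers and
   have a comparable total mass.  They are explicit, and when [chi] is negligible
   with respect to the number of vertices they are nearly constant over long
   windows around their mode.  Hence [delta = max_k P(X = k)] tends to [0], and
   the standard deviation [sigma] of [X] tends to infinity.

   Stein's method, applied to the indicator of a half-line, bounds the distance
   between the standardized distribution function of [X] and the normal one by
   [C / sigma + 12 * delta], uniformly. *)

(** * Proper colorings and chromatic roots *)

Section Colorings.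
Implicit Types G H : sgraph.

Lemma proper_coloringP G q (c : {ffun G -> 'I_q}) :
  reflect (forall x y, adj x y -> c x != c y) (proper_coloring c).
Proof.
apply: (iffP forallP) => [cP x y|cP x].
  by move/forallP/(_ y)/implyP: (cP x).
by apply/forallP => y; apply/implyP; exact: cP.
Qed.

Lemma graph_iso_sym G H : graph_iso G H -> graph_iso H G.
Proof.
case=> f [g fK gK] fadj; exists g; first by exists f.
by move=> x y; rewrite -fadj !gK.
Qed.

Lemma num_colorings_iso G H q : graph_iso G H ->
  num_colorings G q = num_colorings H q.
Proof.
suff le G1 H1 : graph_iso G1 H1 -> (num_colorings H1 q <= num_colorings G1 q)%N.
  by move=> iGH; apply/eqP; rewrite eqn_leq !le //; exact: graph_iso_sym.
case=> f [g fK gK] fadj.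
pose pull (c : {ffun H1 -> 'I_q}) : {ffun G1 -> 'I_q} := [ffun x => c (f x)].
have pull_inj : injective pull.
  move=> c d /ffunP e; apply/ffunP => y; rewrite -[y]gK.
  by have := e (g y); rewrite !ffunE.
rewrite /num_colorings -(card_imset _ pull_inj); apply: subset_leq_card.
apply/subsetP => d /imsetP[c]; rewrite !inE => /proper_coloringP cP ->.
by apply/proper_coloringP => x y xy; rewrite !ffunE cP // fadj.
Qed.

Lemma card_graph_iso G H : graph_iso G H -> #|G| = #|H|.
Proof. by case=> f /bij_eq_card. Qed.

Lemma num_colorings_disjoint_union G H q :
  num_colorings (disjoint_union G H) q = (num_colorings G q * num_colorings H q)%N.
Proof.
pose glue (cd : {ffun G -> 'I_q} * {ffun H -> 'I_q}) :
  {ffun disjoint_union G H -> 'I_q} :=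
  [ffun u => match u with inl x => cd.1 x | inr y => cd.2 y end].
have glue_inj : injective glue.
  move=> [c d] [c' d'] /ffunP e; congr pair; apply/ffunP => x.
    by have := e (inl x); rewrite !ffunE.
  by have := e (inr x); rewrite !ffunE.
rewrite /num_colorings -cardsX -(card_imset _ glue_inj).
congr #|pred_of_set _|; apply/setP => e; rewrite inE; apply/idP/imsetP.
  move=> /proper_coloringP eP.
  exists ([ffun x => e (inl x)], [ffun y => e (inr y)]).
    rewrite !inE; apply/andP; split; apply/proper_coloringP => x y xy;
    by rewrite !ffunE eP.
  by apply/ffunP => -[x|y]; rewrite !ffunE.
case=> -[c d]; rewrite !inE => /andP[/proper_coloringP cP /proper_coloringP dP] ->.
by apply/proper_coloringP => -[x|x] [y|y] //= xy; rewrite !ffunE /= (cP, dP).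
Qed.

(** The color [i] of the dominating vertex occurs nowhere else, and [lift i] identifies ['I_q] with
    the [q] remaining colors. *)
Lemma num_colorings_add_dominating G q :
  num_colorings (add_dominating G) q.+1 = (q.+1 * num_colorings G q)%N.
Proof.
pose glue (ic : 'I_q.+1 * {ffun G -> 'I_q}) : {ffun add_dominating G -> 'I_q.+1} :=
  [ffun u => if u is Some x then lift ic.1 (ic.2 x) else ic.1].
have glue_inj : injective glue.
  move=> [i c] [j d] /ffunP e.
  have ij : i = j by have := e None; rewrite !ffunE.
  rewrite -{}ij in e *; congr pair; apply/ffunP => x.
  by have := e (Some x); rewrite !ffunE => /lift_inj.
rewrite /num_colorings -[q.+1 in RHS]card_ord -cardsT -cardsX -(card_imset _ glue_inj).
congr #|pred_of_set _|; apply/setP => e; rewrite inE; apply/idP/imsetP.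
  move=> /proper_coloringP eP.
  have eN x : e None != e (Some x) by exact: eP.
  pose c x := sval (unlift_some (eN x)).
  have cE x : e (Some x) = lift (e None) (c x).
    by rewrite /c; case: unlift_some.
  exists (e None, [ffun x => c x]); last first.
    by apply/ffunP => -[x|]; rewrite !ffunE.
  rewrite !inE /=; apply/proper_coloringP => x y xy; rewrite !ffunE.
  by have := eP (Some x) (Some y) xy; rewrite !cE (inj_eq (@lift_inj _ _)).
case=> -[i c]; rewrite !inE /= => /proper_coloringP cP ->.
apply/proper_coloringP => -[x|] [y|] //= xy; rewrite !ffunE /=.
- by rewrite (inj_eq (@lift_inj _ _)) cP.
- by rewrite eq_sym neq_lift.
- by rewrite neq_lift.
Qed.

Lemma num_colorings_0 G : (0 < #|G|)%N -> num_colorings G 0 = 0%N.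
Proof.
move=> /card_gt0P[x _]; apply/eqP; rewrite cards_eq0; apply/eqP/setP => c.
by have := ltn_ord (c x).
Qed.

(* The roots of the chromatic polynomial of a quasi-threshold graph are the
   depths of the vertices in the forest that describes its construction. *)
Lemma quasi_threshold_num_colorings G : quasi_threshold G ->
  exists cs : seq nat, [/\ size cs = #|G|,
    forall q, (num_colorings G q)%:R = \prod_(c <- cs) (q%:R - c%:R) :> int,
    0%N \in cs & forall c, c.+1 \in cs -> c \in cs].
Proof.
elim=> {G} [|G _ [cs [szcs numE cs0 cs_closed]]
  |G H _ [cs [szcs numcs cs0 cs_closed]] _ [ds [szds numds ds0 ds_closed]]
  |G H iGH _ [cs [szcs numE cs0 cs_closed]]].
- exists [:: 0%N]; split; rewrite ?card_unit // => q.
  rewrite big_seq1 subr0 /num_colorings (_ : [set c | _] = [set: {ffun K1 -> 'I_q}]).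
    by rewrite cardsT card_ffun card_ord card_unit expn1.
  by apply/setP => c; rewrite !inE; apply/proper_coloringP.
- exists (0%N :: [seq c.+1 | c <- cs]); split.
  + by rewrite /= size_map szcs card_option.
  + move=> [|q]; rewrite big_cons subr0.
      by rewrite num_colorings_0 ?card_option // mul0r.
    rewrite num_colorings_add_dominating natrM numE big_map; congr (_ * _).
    by apply: eq_bigr => c _; rewrite -!natr1; ring.
  + by rewrite inE.
  + move=> c; rewrite inE /= mem_map; last exact: succn_inj.
    case: c => [|c] // /cs_closed; rewrite inE /= mem_map //; exact: succn_inj.
- exists (cs ++ ds); split.
  + by rewrite size_cat szcs szds card_sum.
  + by move=> q; rewrite num_colorings_disjoint_union natrM numcs numds big_cat.
  + by rewrite mem_cat cs0.
  + by move=> c; rewrite !mem_cat => /orP[/cs_closed ->|/ds_closed ->]; rewrite ?orbT.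
- exists cs; split=> //; first by rewrite szcs; exact: card_graph_iso.
  by move=> q; rewrite -(num_colorings_iso q iGH).
Qed.

Lemma num_colorings_le G q : (num_colorings G q <= q ^ #|G|)%N.
Proof.
by apply: leq_trans (max_card _) _; rewrite card_ffun card_ord.
Qed.

Lemma num_colorings_ge G q : (q ^_ #|G| <= num_colorings G q)%N.
Proof.
rewrite -{1}(card_ord q) -card_inj_ffuns; apply: subset_leq_card.
apply/subsetP => c; rewrite !inE => /injectiveP c_inj.
apply/proper_coloringP => x y xy; apply: contraTneq xy => /c_inj ->.
by rewrite adj_irr.
Qed.

Lemma expn_le_ffact x m : (x ^ m <= (x + m) ^_ m)%N.
Proof.
elim: m => [|m IH] //.
by rewrite addnS ffactnS /= expnS leq_mul // -addnS leq_addr.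
Qed.

(* Both graphs have between [q ^_ n] and [q ^ n] colorings, [n] being the number
   of vertices, so [n] is determined by the growth rate. *)
Lemma card_eq_num_colorings G H : num_colorings G =1 num_colorings H -> #|G| = #|H|.
Proof.
suff le (G1 H1 : sgraph) : num_colorings G1 =1 num_colorings H1 -> (#|H1| <= #|G1|)%N.
  by move=> e; apply/eqP; rewrite eqn_leq !le // => q; rewrite e.
move=> e; rewrite leqNgt; apply/negP => lt.
(* This [x] satisfies [x + m <= 2 * x] and [2 ^ m.-1 < x], so that [x ^ m] exceeds
   [(2 * x) ^ m.-1]. *)
set m := #|H1| in lt; pose x := (2 ^ m + m)%N.
have : (x ^ m <= (x + m) ^ #|G1|)%N.
  apply: leq_trans (expn_le_ffact _ _) _; apply: leq_trans (num_colorings_ge _ _) _.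
  by rewrite -e num_colorings_le.
apply/negP; rewrite -ltnNge.
have [n mn] : exists n, m = n.+1 by exists m.-1; rewrite prednK // (leq_trans _ lt).
have x0 : (0 < x)%N by rewrite addn_gt0 expn_gt0.
apply: (@leq_ltn_trans ((2 * x) ^ n)%N).
  apply: (@leq_trans ((2 * x) ^ #|G1|)%N).
    have [->|G0] := posnP #|G1|; first by rewrite !expn0.
    by rewrite leq_exp2r // /x mul2n -addnn leq_add2l leq_addl.
  by rewrite leq_pexp2l ?muln_gt0 // -ltnS -mn.
rewrite mn expnS expnMn ltn_pmul2r ?expn_gt0 ?x0 // /x.
by rewrite mn expnS; have := expn_gt0 2 n; lia.
Qed.

Lemma colorable_num_colorings G q : colorable G q = (0 < num_colorings G q)%N.
Proof.
apply/existsP/card_gt0P => -[c cP]; exists c; first by rewrite inE.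
by move: cP; rewrite inE.
Qed.

(** Sorting the partitions in [num_coloringsE] by their number of blocks exhibits the Stirling
    numbers as the coordinates of the chromatic polynomial in the basis of falling factorials.
    [#|{set G}|] is a crude bound on the number of blocks. *)
Lemma graph_stirling_num_colorings G q :
  (\sum_(k < #|{set G}|.+1) graph_stirling G k%:Z * q ^_ k)%N = num_colorings G q.
Proof.
rewrite num_coloringsE.
rewrite (partition_big (fun P : {set {set G}} => inord #|P| : 'I_#|{set G}|.+1) xpredT) //=.
apply: eq_bigr => k _; rewrite /graph_stirling -sum1_card big_distrl /=.
have cardP (P : {set {set G}}) : (inord #|P| == k) = (#|P| == k :> nat).
  by rewrite -val_eqE /= inordK // ltnS max_card.
apply: eq_big => [P|P]; first by rewrite cardP inE eqz_nat.
by rewrite inE eqz_nat mul1n => /andP[_ /eqP ->].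
Qed.

Lemma graph_stirling_large G k : (#|{set G}| < k)%N -> graph_stirling G k%:Z = 0%N.
Proof.
move=> lk; apply/eqP; rewrite cards_eq0; apply/eqP/setP => P; rewrite !inE.
by rewrite eqz_nat ltn_eqF ?andbF // (leq_ltn_trans (max_card _) lk).
Qed.

(** The chromatic roots are exactly the [q] that admit no proper coloring, hence the numbers below
    the chromatic number; [es] collects their repetitions. Only the numbers of colorings and of
    vertices enter, so the description passes to co-chromatic graphs. *)
Lemma num_colorings_determine G :
  quasi_threshold G \/ (exists2 H : sgraph, quasi_threshold H & cochromatic G H) ->
  exists es : seq nat, [/\ (chromatic_number G + size es)%N = #|G|,
    all (fun e => (e < chromatic_number G)%N) es &
    forall q, (num_colorings G q)%:R
      = \prod_(c <- iota 0 (chromatic_number G) ++ es) (q%:R - c%:R) :> int].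
Proof.
move=> hG; have {hG}[cs [szcs numE cs0 cs_closed]] : exists cs : seq nat,
    [/\ size cs = #|G|,
    forall q, (num_colorings G q)%:R = \prod_(c <- cs) (q%:R - c%:R) :> int,
    0%N \in cs & forall c, c.+1 \in cs -> c \in cs].
  case: hG => [|[H qtH GH]]; first exact: quasi_threshold_num_colorings.
  have eqGH : num_colorings G =1 num_colorings H.
    move=> q; apply/eqP; rewrite -(eqr_nat int).
    by rewrite -(chromatic_polyP G) -(chromatic_polyP H) GH.
  have [cs [szcs numE cs0 cs_closed]] := quasi_threshold_num_colorings qtH.
  exists cs; split=> // [|q]; first by rewrite szcs (card_eq_num_colorings eqGH).
  by rewrite eqGH.
have in_cs q : (q \in cs) = ~~ colorable G q.
  rewrite colorable_num_colorings -eqn0Ngt -(eqr_nat int) numE.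
  rewrite prodf_seq_eq0; apply/idP/hasP => [qcs|[c ccs]].
    by exists q => //=; rewrite subrr.
  by rewrite /= subr_eq0 eqr_nat => /eqP ->.
have chiP c : (c \in cs) = (c < chromatic_number G)%N.
  rewrite /chromatic_number; case: ex_minnP => chi chi_col chi_min.
  apply/idP/idP => [ccs|]; last first.
    by rewrite in_cs; apply: contraL => /chi_min; rewrite leqNgt.
  (* By downward closure a root [c >= chi] would make [chi] a root, although [chi] colors
     suffice. *)
  rewrite ltnNge; apply/negP => /subnKC E; move: ccs; rewrite -E.
  elim: (c - chi)%N => [|k IH]; first by rewrite addn0 in_cs chi_col.
  by rewrite addnS => /cs_closed.
have perm_cs : perm_eq (undup cs) (iota 0 (chromatic_number G)).
  apply: uniq_perm; rewrite ?undup_uniq ?iota_uniq // => c.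
  by rewrite mem_undup chiP mem_iota.
have [es es_perm] := perm_to_subseq (undup_subseq cs).
have cs_perm : perm_eq cs (iota 0 (chromatic_number G) ++ es).
  by apply: perm_trans es_perm _; rewrite perm_cat2r.
exists es; split.
- by rewrite -szcs (perm_size cs_perm) size_cat size_iota.
- by apply/allP => e ees; rewrite -chiP (perm_mem cs_perm) mem_cat ees orbT.
- by move=> q; rewrite numE; apply: perm_big.
Qed.

Lemma graph_stirling_neg G n : graph_stirling G (Negz n) = 0%N.
Proof.
by apply/eqP; rewrite cards_eq0; apply/eqP/setP => P; rewrite !inE andbF.
Qed.

End Colorings.

(** * Real-rootedness *)

Section FallingFactorialBasis.
Variable R : numDomainType.
Implicit Types p : {poly R}.

(* The value at [q] of the polynomial whose coefficients in the basis of falling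
   factorials are those of [p] in the basis of monomials. *)
Definition fall (q : nat) p : R := \sum_(k < size p) p`_k * (q ^_ k)%:R.

Lemma fall_widen n q p : (size p <= n)%N ->
  fall q p = \sum_(k < n) p`_k * (q ^_ k)%:R.
Proof.
move=> szp; rewrite /fall (big_ord_widen n (fun k => p`_k * (q ^_ k)%:R)) //.
rewrite big_mkcond; apply: eq_bigr => k _; case: ltnP => // szk.
by rewrite nth_default ?mul0r.
Qed.

(** This is [q * q ^_ k = q ^_ k.+1 + k * q ^_ k] on coefficients: the first term is multiplication
    by ['X], the second is ['X] times the derivative. *)
Lemma fall_step q (c : R) p :
  fall q ('X * p + 'X * p^`() - c *: p) = (q%:R - c) * fall q p.
Proof.
have [n szp] : exists n, (size p <= n)%N by exists (size p).
rewrite (@fall_widen n.+1); last first.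
  apply: leq_trans (size_polyD _ _) _; rewrite geq_max size_polyN.
  rewrite (leq_trans (size_scale_leq _ _)) ?(leq_trans szp) // andbT.
  apply: leq_trans (size_polyD _ _) _; rewrite geq_max.
  rewrite !(leq_trans (size_polyMleq _ _)) // size_polyX add2n /= ltnS //.
  by apply: leq_trans szp; apply: leq_trans (size_poly _ _) (leq_pred _).
have -> : \sum_(k < n.+1) ('X * p + 'X * p^`() - c *: p)`_k * (q ^_ k)%:R
  = \sum_(k < n) p`_k * (q ^_ k.+1)%:R
    + \sum_(k < n.+1) (k%:R - c) * p`_k * (q ^_ k)%:R.
  rewrite [in LHS]big_ord_recl [in X in _ = _ + X]big_ord_recl.
  rewrite addrCA -big_split /=; congr (_ + _).
    by rewrite !coefD !coefXM coefN coefZ /=; ring.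
  apply: eq_bigr => i _; rewrite !coefD !coefXM coefN coefZ coef_deriv /=.
  by rewrite /bump /= add1n -mulr_natr; ring.
rewrite big_ord_recr /= [p`_n]nth_default // mulr0 mul0r addr0 -big_split /=.
rewrite (fall_widen q szp) mulr_sumr; apply: eq_bigr => k _.
rewrite ffactnSr natrM; have [kq|qk] := leqP k q; first by rewrite natrB //; ring.
by rewrite ffact_small // !(mul0r, mulr0, addr0).
Qed.

Lemma fallXn q n : fall q 'X^n = (q ^_ n)%:R.
Proof.
rewrite (@fall_widen n.+1) ?size_polyXn // big_ord_recr /= coefXn eqxx mul1r.
by rewrite big1 ?add0r // => k _; rewrite coefXn ltn_eqF // mul0r.
Qed.

(* Evaluating at [q = k] isolates the [k]-th coefficient from the later ones. *)
Lemma ffact_basis_inj n (a b : nat -> R) :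
  (forall q, \sum_(k < n) a k * (q ^_ k)%:R = \sum_(k < n) b k * (q ^_ k)%:R) ->
  forall k, (k < n)%N -> a k = b k.
Proof.
move=> ab k; elim/ltn_ind: k => k IH kn.
have split_sum (c : nat -> R) : \sum_(j < n) c j * (k ^_ j)%:R
    = \sum_(j < k) c j * (k ^_ j)%:R + c k * k`!%:R.
  transitivity (\sum_(j < k.+1) c j * (k ^_ j)%:R); last first.
    by rewrite big_ord_recr /= ffactnn.
  rewrite (@big_ord_widen _ _ _ k.+1 n (fun j => c j * (k ^_ j)%:R)) //.
  rewrite [RHS]big_mkcond; apply: eq_bigr => j _; case: ltnP => // kj.
  by rewrite ffact_small ?mulr0.
have := ab k; rewrite !split_sum.
rewrite (eq_bigr (fun j : 'I_k => b j * (k ^_ j)%:R)) => [/addrI/mulIf|j _].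
  by apply; rewrite pnatr_eq0 -lt0n fact_gt0.
by rewrite IH // (ltn_trans _ kn).
Qed.

End FallingFactorialBasis.

(** * Real roots of the generating polynomial *)

Section RealRoots.
Variable R : rcfType.
Implicit Types p : {poly R}.

(** Keeps what surrounds a consecutive pair in view: the sign at two neighboring roots involves the
    factors of all the other roots. *)
Lemma sorted_split (T : Type) (e : rel T) (s : seq T) :
  (forall l a b r, s = l ++ a :: b :: r -> e a b) -> sorted e s.
Proof.
elim: s => [|a [|b s] IH] // es; rewrite /= (es [::] a b s) //.
by apply: IH => l c d r E; apply: (es (a :: l) c d r); rewrite E.
Qed.

(** The intermediate value theorem gives one root in each gap. The bound by the last point later
    makes all the roots negative. *)
Lemma sign_change_roots p x s :
  path (fun u v => (u < v) && (p.[u] * p.[v] < 0)) x s ->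
  exists ys, [/\ size ys = size s, path <%R x ys, all (root p) ys
    & all (< last x s) ys].
Proof.
elim: s x => [|y s IH] x /=; first by exists [::].
case/andP=> /andP[xy pxy] /[dup] ps /IH [ys [szys ysP rys ltys]].
have [z /[!in_itv] /= /andP[xz zy] rz] := poly_ivtoo (ltW xy) pxy.
have yls : y <= last y s.
  have /(order_path_min lt_trans) /allP yl : path <%R y s.
    by apply: sub_path ps => u v /andP[].
  by case: (s) yl => [|w s'] // yl; rewrite ltW // yl //= mem_last.
exists (z :: ys); split=> /=; rewrite ?szys ?xz ?rz //.
  by case: (ys) ysP => //= w ys' /andP[yw ->]; rewrite (lt_trans zy).
by rewrite ltys (lt_le_trans zy).
Qed.

Lemma deriv_root_XsubC (a : R) p : (('X - a%:P) * p)^`().[a] = p.[a].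
Proof. by rewrite derivM derivXsubC !hornerE subrr mul0r addr0. Qed.

Lemma horner_prod_XsubC (s : seq R) (x : R) :
  (\prod_(t <- s) ('X - t%:P)).[x] = \prod_(t <- s) (x - t).
Proof. by rewrite horner_prod; apply: eq_bigr => t _; rewrite !hornerE. Qed.

(* With [w = X (X - t_1) ... (X - t_n)], the value at each root of [w] of the
   polynomial below has the sign of [w'], so it alternates along the roots. *)
Lemma step_real_roots (ts : seq R) (a : R) :
  0 < a -> sorted <%R ts -> all (< 0) ts ->
  let p := \prod_(t <- ts) ('X - t%:P) in
  exists ys, [/\ size ys = (size ts).+1, sorted <%R ys, all (< 0) ys
    & 'X * p + 'X * p^`() + a *: p = \prod_(y <- ys) ('X - y%:P)].
Proof.
move=> a0 tsS ts0 p; set T := 'X * p + 'X * p^`() + a *: p.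
pose us := rcons ts 0; pose w := \prod_(t <- us) ('X - t%:P).
have usS : sorted <%R us.
  rewrite /us; case: (ts) tsS ts0 => //= t ts' tsP tts0.
  by rewrite rcons_path tsP; apply: (allP (tts0 : all (< 0) (t :: ts'))) (mem_last _ _).
have wE : w = 'X * p by rewrite /w big_rcons /= subr0 mulrC.
have szp : size p = (size ts).+1 by rewrite size_prod_XsubC.
have p_monic : p \is monic by rewrite rpred_prod // => t _; rewrite monicXsubC.
have szXp : size ('X * p) = (size ts).+2.
  by rewrite mulrC size_mulX ?szp // monic_neq0.
have sz_rest : (size ('X * p^`() + a *: p)%R < size ('X * p)%R)%N.
  rewrite szXp ltnS; apply: leq_trans (size_polyD _ _) _; rewrite geq_max.
  rewrite (leq_trans (size_scale_leq _ _)) ?szp // andbT.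
  apply: leq_trans (size_polyMleq _ _) _; rewrite size_polyX add2n /=.
  by apply: leq_trans (lt_size_deriv _) _; rewrite ?monic_neq0 // szp.
have szT : size T = (size ts).+2 by rewrite /T -addrA size_polyDl // szXp.
have T_monic : T \is monic.
  by rewrite monicE /T -addrA lead_coefDl // mulrC lead_coefMX -monicE.
(* At [0], [T] reduces to [a * p] and the derivative of [w] to [p]; at a root [u] of [p], both
   reduce to [u] times the derivative of [p]. *)
have T_w u : u \in us -> exists2 c, 0 < c & T.[u] = c * w^`().[u].
  rewrite mem_rcons inE => /orP[/eqP ->|ut].
    by exists a => //; rewrite wE derivM derivX /T !hornerE; ring.
  exists 1 => //; rewrite wE derivM derivX /T !hornerE.
  have /rootP -> : root p u by rewrite root_prod_XsubC.
  ring.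
have us_path : sorted (fun u v => (u < v) && (T.[u] * T.[v] < 0)) us.
  apply: sorted_split => l b c r E.
  have : pairwise <%R us by rewrite -sorted_pairwise //; exact: lt_trans.
  rewrite E pairwise_cat /= => /and3P[lbcr _ /and3P[/andP[bc br] cr _]].
  rewrite bc /=.
  have [|u bu ->] := T_w b; first by rewrite E mem_cat mem_head orbT.
  have [|v cv ->] := T_w c.
    by rewrite E mem_cat !inE eqxx !orbT.
  rewrite mulrACA pmulr_rlt0 ?mulr_gt0 //.
  (* Once the factors of [b] and [c] are split off, the derivatives of [w] there are [(b - c) *
     P.[b]] and [(c - b) * P.[c]], and [P] keeps its sign between neighboring roots of [w]. *)
  pose P := \prod_(t <- l ++ r) ('X - t%:P).
  have wbc : w = ('X - b%:P) * (('X - c%:P) * P).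
    by rewrite /w E big_cat !big_cons /P big_cat /=; ring.
  have -> : w^`().[b] = (b - c) * P.[b] by rewrite wbc deriv_root_XsubC !hornerE.
  have -> : w^`().[c] = (c - b) * P.[c].
    by rewrite wbc mulrCA deriv_root_XsubC !hornerE.
  have Pbc : 0 < P.[b] * P.[c].
    rewrite !horner_prod_XsubC -big_split /= big_seq prodr_gt0 // => t.
    rewrite mem_cat => /orP[tl|tr].
      have /and3P[tb tc _] := allP lbcr t tl.
      by rewrite mulr_gt0 // subr_gt0.
    by rewrite nmulr_lgt0 subr_lt0 ?(allP cr) // (allP br).
  rewrite mulrACA nmulr_rlt0 //.
  by rewrite nmulr_rlt0 ?subr_gt0 // subr_lt0.
have [t0 [rest us_eq]] : exists t0 rest, us = t0 :: rest.
  by rewrite /us; case: (ts) => [|t ts']; [exists 0, [::] | exists t, (rcons ts' 0)].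
(* [T] and [w] are monic of the same degree, so [T * w] has even degree and is positive far to the
   left; substituting [- 'X] moves this to plus infinity. *)
have [u ut0 Twu] : exists2 u, u < t0 & 0 < T.[u] * w.[u].
  pose q := (T * w) \Po (- 'X).
  have w_monic : w \is monic by rewrite wE monicMl ?monicX.
  have lq : lead_coef q = 1.
    rewrite lead_coef_comp ?size_polyN ?size_polyX //.
    rewrite (monicP (rpredM T_monic w_monic)) lead_coefN lead_coefX mul1r.
    rewrite size_mul ?monic_neq0 // szT wE szXp.
    have -> : ((size ts).+2 + (size ts).+2).-1.-1 = (size ts).+1.*2 by lia.
    by rewrite -signr_odd odd_double.
  have [|x qx] := @poly_pinfty_gt_lc _ q; first by rewrite lq.
  exists (- Num.max x (1 - t0)).
    by rewrite ltrNl lt_max; apply/orP; right; lra.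
  rewrite -hornerM; have := qx (Num.max x (1 - t0)).
  by rewrite lq horner_comp !hornerE le_max lexx => /(_ isT); apply: lt_le_trans.
have first_step : T.[u] * T.[t0] < 0.
  have [|c c0 ->] := T_w t0; first by rewrite us_eq mem_head.
  pose P := \prod_(t <- rest) ('X - t%:P).
  have wP : w = ('X - t0%:P) * P by rewrite /w us_eq big_cons.
  have PP : 0 < P.[u] * P.[t0].
    rewrite !horner_prod_XsubC -big_split /= big_seq prodr_gt0 // => t trest.
    have t0t : t0 < t.
      by move: usS; rewrite us_eq /= => /(order_path_min lt_trans)/allP; apply.
    by rewrite nmulr_lgt0 subr_lt0 // (lt_trans ut0).
  move: Twu; rewrite mulrCA pmulr_rlt0 // wP deriv_root_XsubC.
  rewrite hornerM hornerXsubC ltNge => TuP; rewrite ltNge.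
  apply/negP => TC; move: TuP; apply/negP/negPn.
  have : 0 <= (T.[u] * P.[t0]) * (P.[u] ^+ 2 * (t0 - u)).
    by rewrite mulr_ge0 // mulr_ge0 ?sqr_ge0 // subr_ge0 ltW.
  have -> : (T.[u] * P.[t0]) * (P.[u] ^+ 2 * (t0 - u))
    = - (T.[u] * ((u - t0) * P.[u]) * (P.[u] * P.[t0])) by ring.
  by rewrite oppr_ge0 pmulr_lle0.
(* With [u] in front of the points of [us], there are as many sign changes as the degree of [T], all
   to the left of [0]. *)
have [|ys [szys ysP rys ys0]] := @sign_change_roots T u us.
  by rewrite us_eq /= ut0 first_step; move: us_path; rewrite us_eq.
have ysS : sorted <%R ys by case: (ys) ysP => //= y ys' /andP[].
exists ys; split=> //; rewrite ?szys ?size_rcons //.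
  by move: ys0; rewrite last_rcons.
rewrite -/T [LHS](@all_roots_prod_XsubC _ T ys) ?(monicP T_monic) ?scale1r //.
  by rewrite szT szys size_rcons.
by rewrite uniq_rootsE lt_sorted_uniq.
Qed.

(** Induction on [es]. Applied to ['X^chi * p], the operator of [fall_step] acts on the cofactor as
    ['X * p + 'X * p' + (chi - e) * p], with [p'] the derivative, and [e < chi] gives the positive
    constant that [step_real_roots] asks for. *)
Lemma real_rooted_falling (chi : nat) (es : seq nat) :
  all (fun e => (e < chi)%N) es ->
  exists rs : seq R, [/\ size rs = size es, all (fun r => 0 <= r) rs &
    forall q, fall q ('X^chi * \prod_(r <- rs) ('X + r%:P))
      = (q ^_ chi)%:R * \prod_(e <- es) (q%:R - e%:R)].
Proof.
move=> es_chi; suff [ts [szts _ ts0 fallE]] : exists ts : seq R,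
    [/\ size ts = size es, sorted <%R ts, all (< 0) ts &
    forall q, fall q ('X^chi * \prod_(t <- ts) ('X - t%:P))
      = (q ^_ chi)%:R * \prod_(e <- es) (q%:R - e%:R)].
  exists [seq - t | t <- ts]; split; first by rewrite size_map.
    by rewrite all_map; apply: sub_all ts0 => t /= t0; rewrite oppr_ge0 ltW.
  by move=> q; rewrite -fallE big_map; under eq_bigr => t _ do rewrite polyCN.
elim: es es_chi => [_|e es IH /= /andP[e_chi /IH [ts [szts tsS ts0 fallE]]]].
  by exists [::]; split=> // q; rewrite !big_nil !mulr1 fallXn.
have ce0 : 0 < (chi - e)%:R :> R by rewrite ltr0n subn_gt0.
have [ys [szys ysS ys0 ysE]] := step_real_roots ce0 tsS ts0.
exists ys; split; rewrite ?szys ?szts // => q.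
rewrite -ysE big_cons mulrCA -fallE -fall_step; congr fall.
move: (\prod_(t <- ts) _) => p; rewrite derivM derivXn natrB ?(ltnW e_chi) //.
have [c ->] : exists c, chi = c.+1.
  by exists chi.-1; rewrite prednK // (leq_ltn_trans _ e_chi).
rewrite /= exprS -!mul_polyC !polyCB polyC_natr -mulr_natr.
ring.
Qed.

End RealRoots.

(** * Sums of independent Bernoulli variables *)

Section PoissonBinomial.
Variable R : realFieldType.
Implicit Types (s : seq R) (g h : nat -> R) (p : R).

(* Expectation of [g X], where [X] is a sum of independent Bernoulli variables
   with the success probabilities in [s]. *)
Fixpoint pb s g : R :=
  if s is p :: s' then (1 - p) * pb s' g + p * pb s' (g \o succn) else g 0%N.

(* The sum over [p] in [s] of [p (1 - p)] times the expectation of [g] under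
   [s] with [p] removed. *)
Fixpoint pb_stein s g : R :=
  if s is p :: s' then
    p * (1 - p) * pb s' g + (1 - p) * pb_stein s' g
    + p * pb_stein s' (g \o succn)
  else 0.

Definition pb_mean s : R := \sum_(p <- s) p.
Definition pb_var s : R := \sum_(p <- s) p * (1 - p).

Definition probs s := all (fun p => 0 <= p <= 1) s.

Lemma eq_pb s g h : g =1 h -> pb s g = pb s h.
Proof.
elim: s g h => [|p s IH] g h gh /=; first exact: gh.
by rewrite (IH g h) // (IH (g \o succn) (h \o succn)) // => k /=.
Qed.

Lemma pbD s g h : pb s (fun k => g k + h k) = pb s g + pb s h.
Proof.
elim: s g h => [|p s IH] g h //=.
by rewrite IH (IH (g \o succn) (h \o succn)); ring.
Qed.

Lemma pbZ s c g : pb s (fun k => c * g k) = c * pb s g.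
Proof.
elim: s g => [|p s IH] g //=.
by rewrite IH (IH (g \o succn)); ring.
Qed.

Lemma pbN s g : pb s (fun k => - g k) = - pb s g.
Proof. by rewrite -mulN1r -pbZ; apply: eq_pb => k; rewrite mulN1r. Qed.

Lemma pbB s g h : pb s (fun k => g k - h k) = pb s g - pb s h.
Proof. by rewrite (pbD s g (fun k => - h k)) pbN. Qed.

Lemma pb_cst s c : pb s (fun=> c) = c.
Proof.
elim: s => //= p s IH.
rewrite (_ : pb s (_ \o _) = pb s (fun=> c)); last exact: eq_pb.
by rewrite IH; ring.
Qed.

Lemma pb_sum (I : Type) (r : seq I) (F : I -> nat -> R) s :
  pb s (fun k => \sum_(i <- r) F i k) = \sum_(i <- r) pb s (F i).
Proof.
elim: r => [|i r IH].
  by rewrite big_nil -[RHS](pb_cst s); apply: eq_pb => k; rewrite big_nil.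
by rewrite big_cons -IH -pbD; apply: eq_pb => k; rewrite big_cons.
Qed.

Lemma ler_pb s g h : probs s -> (forall k, g k <= h k) -> pb s g <= pb s h.
Proof.
elim: s g h => [|p s IH] g h /=; first by move=> _; apply.
case/andP=> /andP[p0 p1] sP gh; apply: lerD.
  by apply: ler_wpM2l; [lra | exact: IH].
by apply: ler_wpM2l => //; apply: IH => // k /=.
Qed.

Lemma ler_norm_pb s g : probs s -> `|pb s g| <= pb s (fun k => `|g k|).
Proof.
move=> sP; rewrite ler_norml -pbN.
by apply/andP; split; apply: ler_pb => // k; [exact: lerNnormlW | exact: ler_norm].
Qed.

Lemma eq_pb_stein s g h : g =1 h -> pb_stein s g = pb_stein s h.
Proof.
elim: s g h => [|p s IH] g h gh //=.
rewrite (eq_pb s gh) (IH g h) // (IH (g \o succn) (h \o succn)) // => k /=.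
exact: gh.
Qed.

(** By conditioning on the first variable: recentering by [p] leaves [p * (1 - p)] times the
    expected increment of [g] over the remaining variables. Constant and linear [g] yield the mean
    and the variance. *)
Lemma pb_stein_identity s g :
  pb s (fun k => (k%:R - pb_mean s) * g k)
  = pb_stein s (fun k => g k.+1 - g k).
Proof.
elim: s g => [|p s IH] g /=; first by rewrite /pb_mean big_nil subrr mul0r.
have -> : pb_stein s ((fun k => g k.+1 - g k) \o succn)
  = pb s (fun k => (k%:R - pb_mean s) * (g \o succn) k) by rewrite IH.
rewrite -(IH g) /pb_mean big_cons -/(pb_mean s) pbB.
set m := pb_mean s.
have -> : pb s (fun k => (k%:R - (p + m)) * g k)
  = pb s (fun k => (k%:R - m) * g k) - p * pb s g.
  by rewrite -pbZ -pbB; apply: eq_pb => k; ring.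
have -> : pb s ((fun k => (k%:R - (p + m)) * g k) \o succn)
  = pb s (fun k => (k%:R - m) * (g \o succn) k) + (1 - p) * pb s (g \o succn).
  by rewrite -pbZ -pbD; apply: eq_pb => k /=; rewrite -natr1; ring.
have -> : pb s (fun k => g k.+1) = pb s (g \o succn) by [].
ring.
Qed.

Lemma pb_stein_cst s c : pb_stein s (fun=> c) = pb_var s * c.
Proof.
elim: s => [|p s IH]; first by rewrite /pb_var big_nil mul0r.
rewrite /= (@eq_pb_stein s (_ \o _) (fun=> c)) // IH pb_cst.
by rewrite /pb_var big_cons; ring.
Qed.

(** The full sum exceeds the sum without one variable by [0] or [1], and the hypotheses compare
    [g k] with [phi] at both [k] and [k.+1]. Every expectation with a variable removed can thus be
    replaced by one under the full sum. *)
Lemma pb_stein_approx s (g phi zeta : nat -> R) : probs s ->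
  (forall k, `|g k - phi k| <= zeta k) ->
  (forall k, `|g k - phi k.+1| <= zeta k.+1) ->
  `|pb_stein s g - pb_var s * pb s phi| <= pb_var s * pb s zeta.
Proof.
elim: s g phi zeta => [|p s IH] g phi zeta /=.
  by rewrite /pb_var big_nil !mul0r subrr normr0.
case/andP=> /andP[p0 p1] sP h1 h2; rewrite /pb_var big_cons -/(pb_var s).
have q0 : 0 <= 1 - p by lra.
set V := pb_var s.
have b1 := IH g phi zeta sP h1 h2.
have b2 : `|pb_stein s (g \o succn) - V * pb s (phi \o succn)|
  <= V * pb s (zeta \o succn) by apply: IH => // k /=.
have e1 : `|pb s g - pb s phi| <= pb s zeta.
  by rewrite -pbB; apply: le_trans (ler_norm_pb _ sP) _; exact: ler_pb.
have e2 : `|pb s g - pb s (phi \o succn)| <= pb s (zeta \o succn).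
  by rewrite -pbB; apply: le_trans (ler_norm_pb _ sP) _; exact: ler_pb.
move: b1 b2 e1 e2; rewrite -/V.
set A := pb_stein s g; set B := pb_stein s _; set C := pb s g.
set P := pb s phi; set Q := pb s (phi \o succn).
set Z := pb s zeta; set Y := pb s (zeta \o succn) => b1 b2 e1 e2.
have -> : p * (1 - p) * C + (1 - p) * A + p * B
    - (p * (1 - p) + V) * ((1 - p) * P + p * Q)
  = p * (1 - p) * ((1 - p) * (C - P) + p * (C - Q))
    + ((1 - p) * (A - V * P) + p * (B - V * Q)) by ring.
have -> : (p * (1 - p) + V) * ((1 - p) * Z + p * Y)
  = p * (1 - p) * ((1 - p) * Z + p * Y)
    + ((1 - p) * (V * Z) + p * (V * Y)) by ring.
have mix a b a' b' : `|a| <= a' -> `|b| <= b' ->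
    `|(1 - p) * a + p * b| <= (1 - p) * a' + p * b'.
  move=> ha hb; apply: le_trans (ler_normD _ _) _.
  by rewrite !normrM (ger0_norm q0) (ger0_norm p0) lerD // ler_wpM2l.
apply: le_trans (ler_normD _ _) _; apply: lerD; last exact: mix.
by rewrite normrM ger0_norm ?mulr_ge0 // ler_wpM2l ?mulr_ge0 //; exact: mix.
Qed.

Lemma pb_id s : pb s (fun k => k%:R) = pb_mean s.
Proof.
have := pb_stein_identity s (fun=> 1).
rewrite (@eq_pb_stein _ _ (fun=> 0)) => [|k]; last by rewrite subrr.
rewrite pb_stein_cst mulr0 (@eq_pb _ _ (fun k => k%:R - pb_mean s)).
  by rewrite pbB pb_cst => /eqP; rewrite subr_eq0 => /eqP.
by move=> k; rewrite mulr1.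
Qed.

Lemma pb_variance s : pb s (fun k => (k%:R - pb_mean s) ^+ 2) = pb_var s.
Proof.
have := pb_stein_identity s (fun k => k%:R - pb_mean s).
rewrite (@eq_pb_stein _ _ (fun=> 1)) => [|k]; last first.
  by rewrite -natr1; ring.
by rewrite pb_stein_cst mulr1 => <-; apply: eq_pb => k; rewrite expr2.
Qed.

(** ['X + r] is [1 + r] times [(1 - p) + p * 'X], the generating polynomial of a Bernoulli variable
    with [p = (1 + r)^-1]. *)
Lemma pb_polyE (rs : seq R) g N : all (fun r => 0 <= r) rs ->
  (size rs < N)%N ->
  \sum_(k < N) (\prod_(r <- rs) ('X + r%:P))`_k * g k
  = (\prod_(r <- rs) (1 + r)) * pb [seq (1 + r)^-1 | r <- rs] g.
Proof.
elim: rs g N => [|r rs IH] g [//|N] /=.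
  move=> _ _; rewrite !big_nil mul1r big_ord_recl coef1 mul1r big1 ?addr0 // => i _.
  by rewrite coef1 mul0r.
case/andP=> r0 rs0 szN; rewrite !big_cons.
set P := \prod_(r <- rs) _ in IH *; set C := \prod_(r <- rs) _ in IH *.
have szP : (size P <= N)%N.
  have: size P = (size rs).+1.
    rewrite /P (eq_bigr (fun r => 'X - (- r)%:P)) => [|i _].
      by rewrite size_prod_XsubC.
    by rewrite polyCN opprK.
  by move=> ->.
have -> : \sum_(k < N.+1) (('X + r%:P) * P)`_k * g k
   = \sum_(k < N) P`_k * g k.+1 + r * \sum_(k < N.+1) P`_k * g k.
  rewrite big_distrr /= [in RHS]big_ord_recl [in LHS]big_ord_recl.
  rewrite mulrDl coefD coefXM coefCM /= add0r addrCA mulrA; congr (_ + _).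
  rewrite -big_split /=; apply: eq_bigr => i _.
  by rewrite coefD coefXM coefCM /=; ring.
rewrite (IH (g \o succn)) // (IH g) //; last exact: leqW.
by field; rewrite addrC; apply/lt0r_neq0; lra.
Qed.

End PoissonBinomial.

(** * Concentration of the Stirling numbers *)

Section ModeWindow.
Variable R : realFieldType.

(** The quadratic term is the point: at the mode it bounds the sum of the [u i] by a multiple of the
    square root of the mode. *)
Lemma prod_add1_ge (I : eqType) (r : seq I) (u : I -> R) :
  (forall i, i \in r -> 0 <= u i <= 1) ->
  1 + (2 * (\sum_(i <- r) u i) + (\sum_(i <- r) u i) ^+ 2) / 3
  <= \prod_(i <- r) (1 + u i).
Proof.
elim: r => [|i r IH] ur; first by rewrite !big_nil; lra.
rewrite !big_cons; have /andP[u0 u1] := ur i (mem_head _ _).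
have ur' j : j \in r -> 0 <= u j <= 1.
  by move=> jr; apply: ur; rewrite inE jr orbT.
have := IH ur'; have S0 : 0 <= \sum_(j <- r) u j.
  by rewrite big_seq sumr_ge0 // => j /ur' /andP[].
move: S0; set S := \sum_(j <- r) u j; set P := \prod_(j <- r) _ => S0 leP.
have : 0 <= (1 + u i) * (P - (1 + (2 * S + S ^+ 2) / 3)).
  by rewrite mulr_ge0 ?subr_ge0 //; lra.
have : 0 <= u i * (1 - u i) by rewrite mulr_ge0 // subr_ge0.
have : 0 <= u i * S ^+ 2 by rewrite mulr_ge0 // sqr_ge0.
by rewrite -subr_ge0; nra.
Qed.

(** Weierstrass's product inequality; the induction carries the upper bound [1] along. *)
Lemma prod_sub1_ge (I : eqType) (r : seq I) (u : I -> R) :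
  (forall i, i \in r -> 0 <= u i <= 1) ->
  1 - \sum_(i <- r) u i <= \prod_(i <- r) (1 - u i).
Proof.
move=> ur; suff: 1 - \sum_(i <- r) u i <= \prod_(i <- r) (1 - u i) <= 1.
  by case/andP.
elim: r ur => [|i r IH] ur; first by rewrite !big_nil; lra.
rewrite !big_cons; have /andP[u0 u1] := ur i (mem_head _ _).
have /IH /andP[] : forall j, j \in r -> 0 <= u j <= 1.
  by move=> j jr; apply: ur; rewrite inE jr orbT.
have : 0 <= \prod_(j <- r) (1 - u j).
  rewrite big_seq prodr_ge0 // => j jr; rewrite subr_ge0.
  by have /andP[] := ur j (mem_behead (s := i :: r) jr).
set S := \sum_(j <- r) u j; set P := \prod_(j <- r) _ => P0 h1 h2.
have : 0 <= u i * (1 - P) by rewrite mulr_ge0 // subr_ge0.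
have : 0 <= u i * P by rewrite mulr_ge0.
by move=> *; apply/andP; split; lra.
Qed.

Lemma expr_sub1_ge (x : R) n : 0 <= x <= 1 -> 1 - n%:R * x <= (1 - x) ^+ n.
Proof.
move=> x01; have := @prod_sub1_ge 'I_n (index_enum 'I_n) (fun=> x) (fun _ _ => x01).
by rewrite sumr_const prodr_const card_ord mulr_natl.
Qed.

Variables (es : seq nat) (chi : nat).
Hypothesis es_bounds : forall e, e \in es -> (0 < e <= chi)%N.

(* For [es] the list of the [chi - c], [c] ranging over the chromatic roots left
   once [0, ..., chi - 1] are removed, this is the number of proper colorings
   with [q] colors divided by [q`!], at [q = chi + d]. *)
Definition shifted_weight (d : nat) : R := \prod_(e <- es) (d + e)%:R / d`!%:R.

Let W := shifted_weight.
Let ratio d : R := \prod_(e <- es) (1 + (d + e)%:R^-1) / d.+1%:R.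

Let es_gt0 d e : e \in es -> 0 < (d + e)%:R :> R.
Proof. by move=> /es_bounds /andP[e0 _]; rewrite ltr0n addn_gt0 e0 orbT. Qed.

Let W_gt0 d : 0 < W d.
Proof.
rewrite /W /shifted_weight divr_gt0 ?ltr0n ?fact_gt0 //.
by rewrite big_seq prodr_gt0 // => e; exact: es_gt0.
Qed.

Let WS d : W d.+1 = W d * ratio d.
Proof.
rewrite /W /shifted_weight /ratio factS natrM mulrACA -big_split /= -invfM.
rewrite [d.+1%:R * _]mulrC; congr (_ / _).
apply: eq_big_seq => e /(es_gt0 d) de0.
by rewrite mulrDr mulr1 divff ?gt_eqF // addSn -natr1.
Qed.

Let ratio_le d : ratio d.+1 <= ratio d.
Proof.
rewrite /ratio ler_pM ?invr_ge0 ?ler0n //.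
- rewrite big_seq prodr_ge0 // => e /(es_gt0 d.+1) de.
  by rewrite addr_ge0 // invr_ge0 ltW.
- rewrite big_seq [leRHS]big_seq ler_prod // => e ee.
  rewrite addr_ge0 ?invr_ge0 ?ler0n //= lerD2l lef_pV2 ?posrE ?es_gt0 //.
  by rewrite ler_nat.
- by rewrite lef_pV2 ?posrE ?ltr0n // ler_nat.
Qed.

Let ratio_anti d d' : (d <= d')%N -> ratio d' <= ratio d.
Proof.
move=> /subnK <-; elim: (d' - d)%N => // k IH.
by apply: le_trans IH; rewrite addSn.
Qed.

Let ratio_eventually : exists d, ratio d <= 1.
Proof.
exists (2 ^ size es)%N; rewrite ler_pdivrMr ?ltr0n // mul1r.
apply: (@le_trans _ _ (2 ^+ size es)); last by rewrite -natrX ler_nat.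
set d := (2 ^ _)%N.
have <- (s : seq nat) : \prod_(e <- s) 2 = 2 ^+ size s :> R.
  by elim: s => [|e s IH]; rewrite ?big_nil // big_cons IH exprS.
rewrite big_seq [leRHS]big_seq ler_prod // => e ee.
rewrite addr_ge0 ?invr_ge0 //= (_ : 2 = 1 + 1) ?lerD2l; last by lra.
rewrite invf_le1 ?es_gt0 // ler1n; have /andP[e0 _] := es_bounds ee.
by rewrite addn_gt0 e0 orbT.
Qed.

Let loss m : R := m.+2%:R^-1 + \sum_(e <- es) (m.+1 + e)%:R ^- 2.

(** With [x = m + e], [1 + 1/(x + 1) = (1 + 1/x) * (1 - 1/(x + 1)^2)]. The last factors are handled
    by [prod_sub1_ge], and the quotient of the denominators gives the first term of [loss]. *)
Let ratioS_ge m : ratio m * (1 - loss m) <= ratio m.+1.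
Proof.
have h : \prod_(e <- es) (1 + (m.+1 + e)%:R^-1)
   = \prod_(e <- es) (1 + (m + e)%:R^-1)
     * \prod_(e <- es) (1 - (m.+1 + e)%:R ^- 2) :> R.
  rewrite -big_split /=; apply: eq_big_seq => e ee.
  have := es_gt0 m ee; rewrite addSn -natr1; move: (m + e)%:R => x x0.
  by field; rewrite !gt_eqF // addr_gt0.
have -> : ratio m = \prod_(e <- es) (1 + (m + e)%:R^-1)
   * (m.+2%:R / m.+1%:R) / m.+2%:R.
  rewrite /ratio -mulrA; congr (_ * _); field.
  by rewrite nat1r -natrD !pnatr_eq0.
rewrite /ratio h; set P := \prod_(e <- es) (1 + (m + e)%:R^-1).
have P0 : 0 < P.
  rewrite /P big_seq prodr_gt0 // => e /(es_gt0 m) de.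
  by rewrite addr_gt0 // invr_gt0.
have := @prod_sub1_ge _ es (fun e => (m.+1 + e)%:R ^- 2).
rewrite /loss; set S := \sum_(e <- es) _; set Q := \prod_(e <- es) _ => SQ.
have {}SQ : 1 - S <= Q.
  apply: SQ => e ee; rewrite invr_ge0 exprn_ge0 //=.
  have : 1 <= (m.+1 + e)%:R :> R by rewrite ler1n.
  by move=> ?; rewrite invf_le1 ?exprn_ege1 // exprn_gt0 // es_gt0.
have S0 : 0 <= S.
  by rewrite /S sumr_ge0 // => e _; rewrite invr_ge0 exprn_ge0.
set t := m.+2%:R : R; have t1 : 1 < t by rewrite ltr1n.
have -> : m.+1%:R = t - 1 by rewrite /t -[m.+2%:R]natr1; ring.
have -> : P * (t / (t - 1)) / t * (1 - (t^-1 + S))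
    = P * (1 - S * (t / (t - 1))) / t.
  by field; apply/andP; split; lra.
rewrite ler_pM2r ?invr_gt0; last lra.
rewrite ler_pM2l //; apply: le_trans SQ; rewrite lerD2l lerN2 ler_peMr //.
by rewrite ler_pdivlMr; lra.
Qed.

Let loss_anti m m' : (m <= m')%N -> loss m' <= loss m.
Proof.
move=> mm'; rewrite /loss; apply: lerD.
  by rewrite lef_pV2 ?posrE ?ltr0n // ler_nat.
rewrite big_seq [leRHS]big_seq; apply: ler_sum => e ee.
rewrite lef_pV2 ?posrE ?exprn_gt0 ?es_gt0 // lerXn2r ?nnegrE //.
by rewrite ler_nat leq_add2r.
Qed.

(* The lower bound on [size es] pushes the mode [M] of the weights beyond
   [32 * J ^ 4]; there the successive ratios vary so slowly that the next [J]
   weights are at least half of the maximum. *)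
Lemma mode_window (J : nat) : (0 < J)%N ->
  (2 * (32 * J ^ 4 * (32 * J ^ 4 + chi)) < size es)%N ->
  exists M, forall d j, (j < J)%N ->
    shifted_weight d <= 2 * shifted_weight (M + j).
Proof.
move=> J0 big_es; rewrite -/W.
(* The ratios decrease, so the first index with ratio at most [1] is a mode. *)
have [M Rt1 Mmin] := ex_minnP ratio_eventually.
exists M => d j jJ.
have WleM : W d <= W M.
  have [dM|Md] := leqP d M.
    have: forall k, (k <= M - d)%N -> W d <= W (d + k)%N.
      elim=> [|k IH] kM; first by rewrite addn0.
      apply: le_trans (IH (ltnW kM)) _.
      rewrite addnS WS ler_peMr ?(ltW (W_gt0 _)) //.
      by rewrite leNgt; apply/negP => /ltW /Mmin; lia.
    by move=> /(_ _ (leqnn _)); rewrite subnKC.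
  rewrite -(subnKC (ltnW Md)); elim: (d - M)%N => [|k IH]; first by rewrite addn0.
  rewrite addnS WS; apply: le_trans IH; rewrite ler_piMr ?(ltW (W_gt0 _)) //.
  by apply: le_trans Rt1; apply: ratio_anti; rewrite leq_addr.
apply: le_trans WleM _.
pose D := (32 * J ^ 4)%N.
have D0 : (0 < D)%N by rewrite muln_gt0 expn_gt0 J0.
pose u e : R := (M + e)%:R^-1.
have M0 : (0 < M)%N.
  rewrite lt0n; apply/eqP => M00; move: Rt1; rewrite M00 /ratio divr1 => Rt1.
  suff: 1 < \prod_(e <- es) (1 + (0 + e)%:R^-1) :> R by rewrite ltNge Rt1.
  have := @prod_add1_ge _ es (fun e => (0 + e)%:R^-1).
  set S := \sum_(e <- es) _ => H; apply: lt_le_trans (H _); last first.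
    move=> e ee; rewrite invr_ge0 ler0n invf_le1 ?es_gt0 // ler1n.
    by have /andP[] := es_bounds ee.
  have : 0 < S.
    rewrite /S; case: (es) es_bounds big_es => [|e es'] eb // _.
    rewrite big_cons ltr_pwDl //; last by rewrite sumr_ge0 // => i _; rewrite invr_ge0.
    by rewrite invr_gt0 ltr0n; have /andP[] := eb e (mem_head _ _).
  by have := sqr_ge0 S; lra.
have u01 e : e \in es -> 0 <= u e <= 1.
  move=> ee; rewrite invr_ge0 ler0n invf_le1 ?es_gt0 // ler1n addn_gt0.
  by rewrite M0.
have := prod_add1_ge u01; set S := \sum_(e <- es) u e => leS.
have {}leS : 1 + (2 * S + S ^+ 2) / 3 <= M.+1%:R.
  by move: Rt1; rewrite /ratio ler_pdivrMr ?ltr0n // mul1r; apply: le_trans.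
have S0 : 0 <= S by rewrite /S big_seq sumr_ge0 // => e /u01 /andP[].
have chi0 : (0 < chi)%N.
  case: (es) es_bounds big_es => [|e es'] eb // _.
  by have /andP[e0 /(leq_trans e0)] := eb e (mem_head _ _).
have Sge : (size es)%:R / (M + chi)%:R <= S.
  rewrite (_ : _ / _ = \sum_(e <- es) (M + chi)%:R^-1); last first.
    elim: (es) => [|e s IH]; first by rewrite big_nil mul0r.
    by rewrite big_cons -IH -nat1r mulrDl mul1r.
  rewrite big_seq [leRHS]big_seq; apply: ler_sum => e ee.
  rewrite lef_pV2 ?posrE ?ltr0n ?addn_gt0 ?M0 // ler_nat leq_add2l.
  by have /andP[] := es_bounds ee.
(* For [M <= D], the bounds [size es / (M + chi) <= S] and [S <= 3 / 2 * M] would contradict the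
   lower bound on [size es]. *)
have DM : (D < M)%N.
  rewrite ltnNge; apply/negP => MD.
  have : (size es)%:R <= 3 / 2 * M%:R * (M + chi)%:R :> R.
    rewrite -ler_pdivrMr ?ltr0n ?addn_gt0 ?M0 //; apply: le_trans Sge _.
    by move: leS; rewrite -[M.+1%:R]natr1; have := sqr_ge0 S; lra.
  apply/negP; rewrite -ltNge.
  apply: (@lt_le_trans _ _ (2 * (D * (D + chi)))%:R); last by rewrite ler_nat ltnW.
  rewrite (natrM _ 2) (natrM _ D).
  have h1 : M%:R <= D%:R :> R by rewrite ler_nat.
  have h2 : (M + chi)%:R <= (D + chi)%:R :> R by rewrite ler_nat leq_add2r.
  have h3 : 0 < M%:R :> R by rewrite ltr0n.
  have h4 : 0 < (M + chi)%:R :> R by rewrite ltr0n addn_gt0 M0.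
  have := ler_pM (ltW h3) (ltW h4) h1 h2; have := mulr_gt0 h3 h4.
  rewrite -mulrA; move: (M%:R * _) (D%:R * _) => x y; lra.
pose T : R := M.+1%:R.
have T0 : 0 < T by rewrite ltr0n.
have [m Mm] : exists m, M = m.+1 by exists M.-1; rewrite prednK.
(* Since [M + e >= T], the sum of squares in [loss m] is at most [S / T]. As [(1 + S) ^ 2 <= 3 * T],
   [eps] is at most of order [T ^ (-1/2)], and [32 * J ^ 4 <= T] makes it at most
   [1 / (2 * J ^ 2)]. *)
pose eps := (1 + S) / T.
have loss_eps l : loss (m + l) <= eps.
  apply: le_trans (loss_anti (leq_addr _ _)) _.
  rewrite /loss -Mm /eps mulrDl mul1r lerD2l mulrC big_distrr /=.
  rewrite big_seq [leRHS]big_seq; apply: ler_sum => e ee.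
  rewrite -exprVn expr2 /u ler_wpM2r ?invr_ge0 // lef_pV2 ?posrE ?(es_gt0 _ ee) ?ltr0n //.
  by rewrite ler_nat -addn1 leq_add2l; have /andP[] := es_bounds ee.
have eps0 : 0 <= eps by rewrite divr_ge0 ?addr_ge0 // ltW.
have epsJ : eps * (2 * J%:R ^+ 2) <= 1.
  have DT : 32 * J%:R ^+ 4 <= T.
    by rewrite /T -natrX -natrM ler_nat -/D ltnW // ltnW.
  rewrite /eps mulrAC ler_pdivrMr // mul1r.
  rewrite -(@ler_pXn2r _ 2) ?nnegrE ?mulr_ge0 ?exprn_ge0 ?addr_ge0 ?(ltW T0) //.
  have -> : ((1 + S) * (2 * J%:R ^+ 2)) ^+ 2
    = ((1 + S) ^+ 2 / 3) * (12 * J%:R ^+ 4) by field.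
  rewrite [T ^+ 2]expr2; apply: ler_pM.
  - by rewrite divr_ge0 // sqr_ge0.
  - by rewrite mulr_ge0 ?exprn_ge0.
  - by move: leS; rewrite -/T; nra.
  have : 0 <= J%:R ^+ 4 :> R by rewrite exprn_ge0.
  by move: DT; move: (J%:R ^+ 4) => x; lra.
have J1 : 1 <= J%:R :> R by rewrite ler1n.
have Jeps : 0 <= J%:R * eps <= 1.
  rewrite mulr_ge0 //=; apply: le_trans epsJ; rewrite mulrC ler_wpM2l //.
  nra.
have eps1 : 0 <= eps <= 1.
  by rewrite eps0; case/andP: Jeps => _; apply: le_trans; rewrite ler_peMl.
have ratio_m : 1 <= ratio m.
  by rewrite leNgt; apply/negP => /ltW /Mmin; rewrite Mm ltnn.
have ratio_ge l : (1 - eps) ^+ l <= ratio (m + l).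
  elim: l => [|l IH]; first by rewrite addn0.
  rewrite addnS; apply: le_trans (ratioS_ge _); rewrite exprSr.
  apply: ler_pM => //; rewrite ?exprn_ge0 ?subr_ge0 ?lerD2l ?lerN2 //;
    by case/andP: eps1.
(* Each of the first [J] ratios from the mode on is at least [1 - J * eps], so the weights keep at
   least the fraction [1 - J ^ 2 * eps >= 1 / 2]. *)
have W_ge k : (k <= J)%N -> (1 - J%:R * eps) ^+ k * W M <= W (M + k)%N.
  elim: k => [|k IH] kJ; first by rewrite mul1r addn0.
  rewrite addnS WS exprSr mulrAC; apply: ler_pM.
  - by rewrite mulr_ge0 ?exprn_ge0 ?subr_ge0 ?(ltW (W_gt0 _)) //; case/andP: Jeps.
  - by rewrite subr_ge0; case/andP: Jeps.
  - by rewrite IH // ltnW.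
  rewrite Mm addSnnS; apply: le_trans (ratio_ge _).
  apply: le_trans (expr_sub1_ge _ eps1); rewrite lerD2l lerN2.
  by rewrite ler_wpM2r // ler_nat.
rewrite -ler_pdivrMl //; apply: le_trans (W_ge j (ltnW jJ)).
rewrite ler_wpM2r ?(ltW (W_gt0 _)) //.
apply: le_trans (expr_sub1_ge _ Jeps).
have jJ' : j%:R <= J%:R :> R by rewrite ler_nat ltnW.
have : j%:R * (J%:R * eps) <= J%:R * (J%:R * eps).
  by rewrite ler_wpM2r //; case/andP: Jeps.
by move: epsJ; nra.
Qed.

End ModeWindow.

(** * Factorization of the Stirling polynomial and bound on its coefficients *)

Section StirlingNumbers.
Variable R : rcfType.
Variables (G : sgraph) (es : seq nat) (chi : nat).
Hypothesis es_chi : all (fun e => (e < chi)%N) es.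
Hypothesis numE : forall q,
  (num_colorings G q)%:R = \prod_(c <- iota 0 chi ++ es) (q%:R - c%:R) :> int.

Let stir k : R := (graph_stirling G k%:Z)%:R.

Let num_coloringsR q :
  (num_colorings G q)%:R = (q ^_ chi)%:R * \prod_(e <- es) (q%:R - e%:R) :> R.
Proof.
have /(congr1 (intr : int -> R)) := numE q.
rewrite rmorph_nat rmorph_prod big_cat /= => ->; congr (_ * _); last first.
  by apply: eq_bigr => c _; rewrite rmorphB /= !rmorph_nat.
rewrite -[in iota 0 chi](subn0 chi) -/(index_iota 0 chi) big_mkord.
elim: (chi) => [|n IH]; first by rewrite big_ord0 ffactn0.
rewrite big_ord_recr /= IH ffactnSr natrM rmorphB /= !rmorph_nat.
have [nq|qn] := leqP n q; first by rewrite natrB.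
by rewrite ffact_small // !mul0r.
Qed.

Let stirlingE q :
  \sum_(k < #|{set G}|.+1) stir k * (q ^_ k)%:R = (num_colorings G q)%:R.
Proof.
rewrite -graph_stirling_num_colorings natr_sum.
by apply: eq_bigr => k _; rewrite natrM.
Qed.

(** The Stirling numbers and the coefficients from [real_rooted_falling] expand the same numbers of
    colorings in falling factorials, so [ffact_basis_inj] identifies them. The factor ['X^chi]
    contributes [chi] zeros to [rs]. *)
Lemma graph_stirling_real_rooted : exists rs : seq R,
  [/\ size rs = (chi + size es)%N, all (fun r => 0 <= r) rs &
   forall k : nat, (graph_stirling G k%:Z)%:R = (\prod_(r <- rs) ('X + r%:P))`_k].
Proof.
have [rs [szrs rs0 fallE]] := real_rooted_falling R es_chi.
exists (nseq chi 0 ++ rs); split; first by rewrite size_cat size_nseq szrs.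
  by rewrite all_cat rs0 andbT all_nseq lexx orbT.
have -> : \prod_(r <- nseq chi 0 ++ rs) ('X + r%:P)
   = 'X^chi * \prod_(r <- rs) ('X + r%:P) :> {poly R}.
  by rewrite big_cat big_nseq addr0 iter_mulr_1.
set F := 'X^chi * _ in fallE *.
pose N := maxn #|{set G}|.+1 (size F).
have stir_fall q : \sum_(k < N) stir k * (q ^_ k)%:R
    = \sum_(k < N) F`_k * (q ^_ k)%:R.
  rewrite -fall_widen ?leq_maxr // fallE -num_coloringsR -stirlingE.
  rewrite [RHS](big_ord_widen N (fun k => stir k * (q ^_ k)%:R)) ?leq_maxl //.
  rewrite [RHS]big_mkcond; apply: eq_bigr => k _; case: ltnP => // lk.
  by rewrite /stir graph_stirling_large ?mul0r.
move=> k; have [kN|Nk] := ltnP k N; first exact: (ffact_basis_inj stir_fall).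
rewrite graph_stirling_large; last by rewrite (leq_trans (leq_maxl _ _) Nk).
by rewrite nth_default // (leq_trans (leq_maxr _ _) Nk).
Qed.

Lemma sum_inv_fact_le (n : nat) : \sum_(0 <= j < n) j`!%:R^-1 <= 4 :> R.
Proof.
(* Strengthened for the induction, where [2 ^ n] is at most twice the factorial of [n]. *)
suff : \sum_(0 <= j < n) j`!%:R^-1 <= 4 - 4 * 2 ^- n :> R.
  by move/le_trans; apply; rewrite lerBlDr lerDl mulr_ge0 // invr_ge0 exprn_ge0.
elim: n => [|n IH]; first by rewrite big_nil expr0 invr1 mulr1 subrr.
rewrite big_nat_recr //=; apply: (@le_trans _ _ (4 - 4 * 2 ^- n + 2 * 2 ^- n)).
  apply: lerD IH _.
  rewrite ler_pdivlMr ?exprn_gt0 // mulrC ler_pdivrMr ?ltr0n ?fact_gt0 //.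
  rewrite -natrX -natrM ler_nat.
  elim: n => [|n IH] //; rewrite expnS factS.
  by case: n IH => [|n] // IH; rewrite mulnCA leq_mul.
by rewrite exprS invfM; lra.
Qed.

Let sum_ffact_fact_le k (n : nat) :
  \sum_(0 <= q < n) (q ^_ k)%:R / q`!%:R <= 4 :> R.
Proof.
have small m : (m <= k)%N -> \sum_(0 <= q < m) (q ^_ k)%:R / q`!%:R = 0 :> R.
  move=> mk; rewrite big_nat big1 // => q /andP[_ qm].
  by rewrite ffact_small ?mul0r // (leq_trans qm).
have [/small ->|kn] := leqP n k; first by [].
rewrite (big_cat_nat (n := k)) //=; last exact: ltnW.
rewrite small // add0r -{1}[k]add0n big_addn.
apply: le_trans (sum_inv_fact_le (n - k)); apply: ler_sum => j _.
rewrite -(ffact_fact (leq_addl j k)) addnK natrM invfM mulrA divff ?mul1r //.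
by rewrite pnatr_eq0 -lt0n ffact_gt0 leq_addl.
Qed.

(* [num_colorings G q / q`!] is the sum over [k] of [stir k / (q - k)`!], so it
   is at least [stir q], and its sum over [q] is at most [4] times the sum of
   the [stir k]. *)
Lemma graph_stirling_concentration (J : nat) : (0 < J)%N ->
  (2 * (32 * J ^ 4 * (32 * J ^ 4 + chi)) < size es)%N ->
  forall k : nat,
  J%:R * (graph_stirling G k%:Z)%:R <=
  8 * \sum_(i < #|{set G}|.+1) (graph_stirling G i%:Z)%:R :> R.
Proof.
move=> J0 big_es k; pose w q : R := (num_colorings G q)%:R / q`!%:R.
have wE q : w q = \sum_(i < #|{set G}|.+1) stir i * ((q ^_ i)%:R / q`!%:R).
  by rewrite /w -stirlingE mulr_suml; apply: eq_bigr => i _; rewrite mulrA.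
have stir_le : stir k <= w k.
  have [kB|Bk] := ltnP k #|{set G}|.+1; last first.
    by rewrite /stir graph_stirling_large // divr_ge0.
  rewrite wE (bigD1 (Ordinal kB)) //= ffactnn divff ?mulr1; last first.
    by rewrite pnatr_eq0 -lt0n fact_gt0.
  by rewrite lerDl sumr_ge0 // => i _; rewrite mulr_ge0 ?divr_ge0.
have sum_w n : \sum_(0 <= q < n) w q <= 4 * \sum_(i < #|{set G}|.+1) stir i.
  under eq_bigr => q _ do rewrite wE.
  rewrite exchange_big mulr_sumr; apply: ler_sum => i _ /=.
  by rewrite -mulr_sumr mulrC ler_wpM2r // sum_ffact_fact_le.
pose es' := [seq (chi - e)%N | e <- es].
have es'_bounds e : e \in es' -> (0 < e <= chi)%N.
  by case/mapP=> c /(allP es_chi) cc ->; rewrite subn_gt0 cc leq_subr.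
have w_shift d : w (chi + d)%N = shifted_weight R es' d.
  rewrite /w num_coloringsR /shifted_weight big_map.
  rewrite -(ffact_fact (leq_addr d chi)) addKn natrM invfM.
  rewrite mulrACA [_%:R * _]divff ?mul1r; last first.
    by rewrite pnatr_eq0 -lt0n ffact_gt0 leq_addr.
  congr (_ / _); apply: eq_big_seq => e /(allP es_chi) ec.
  by rewrite natrD natrD natrB ?(ltnW ec) //; ring.
have [M M_window] : exists M, forall d j, (j < J)%N ->
    shifted_weight R es' d <= 2 * shifted_weight R es' (M + j).
  by apply: (mode_window _ es'_bounds J0); rewrite size_map.
have [kchi|chik] := ltnP k chi.
  have : stir k <= 0.
    by apply: le_trans stir_le _; rewrite /w num_coloringsR ffact_small ?mul0r.
  rewrite -/(stir k) => s0; apply: (@le_trans _ _ 0).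
    by rewrite mulr_ge0_le0.
  by rewrite mulr_ge0 // sumr_ge0.
rewrite -/(stir k); apply: le_trans (_ : J%:R * w k <= _).
  by rewrite ler_wpM2l.
have [d kE] : exists d, k = (chi + d)%N by exists (k - chi)%N; rewrite subnKC.
rewrite mulr_natl -[X in _ *+ X]card_ord -sumr_const.
(* The factor [2] of the window and the factor [4] of [sum_w] make up the constant [8]. *)
apply: (@le_trans _ _ (\sum_(j < J) 2 * w (chi + (M + j))%N)).
  by apply: ler_sum => j _; rewrite kE !w_shift; exact: M_window.
rewrite -mulr_sumr (_ : 8 = 2 * 4); last by ring.
rewrite -mulrA ler_wpM2l //.
apply: le_trans (sum_w (chi + M + J)%N).
rewrite (big_cat_nat (n := (chi + M)%N)) //=; last exact: leq_addr.
rewrite -{2}[(chi + M)%N]add0n big_addn addKn.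
rewrite -[leLHS]add0r; apply: lerD.
  by rewrite sumr_ge0 // => q _; rewrite divr_ge0.
by rewrite big_mkord; apply: ler_sum => j _; rewrite addnA [in leRHS]addnC.
Qed.

End StirlingNumbers.

(* Imported only here because [classical_sets] shadows names of [finset]. *)
From mathcomp Require Import all_classical all_reals all_analysis.
From mathcomp Require Import measurable_realfun.
Import numFieldNormedType.Exports.
Local Open Scope classical_set_scope.
Local Open Scope ring_scope.

(** * Stein's method *)

Section NormalCdf.
Variable R : realType.

Let Phi : R -> R := std_normal_cdf.
Let phi : R -> R := normal_pdf 0 1.

Let phiE (w : R) : phi w = normal_peak 1 * expR (- (w ^+ 2 / 2)).
Proof.
rewrite /phi normal_pdfE ?oner_eq0 // /normal_fun subr0 expr1n mulNr.
by rewrite -[1 *+ 2]/(2%:R : R).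
Qed.

Let phi_gt0 (w : R) : 0 < phi w.
Proof. by rewrite phiE mulr_gt0 ?expR_gt0 // normal_peak_gt0 ?oner_eq0. Qed.

Lemma is_derive_std_normal_cdf (w : R) :
  is_derive w 1 (@std_normal_cdf R) (normal_pdf 0 1 w).
Proof.
have h : (lebesgue_measure : {measure set (measurableTypeR R) -> \bar R}).-integrable
    `]-oo, (w + 1)] (EFin \o normal_pdf 0 1).
  by apply: (integrableS _ _ (@subsetT _ _)) (integrable_normal_pdf _ _) => //.
have [] := @continuous_FTC1 R (normal_pdf 0 1) -oo%O w (w + 1) _ h _ _.
- by rewrite ltrDl.
- by rewrite ltNyr.
- by apply: continuous_normal_pdf; rewrite oner_eq0.
move=> dPhi PhiE; apply: DeriveDef; first exact: dPhi.
by rewrite -derive1E -PhiE.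
Qed.

Lemma std_normal_cdf_ge0 (w : R) : 0 <= std_normal_cdf w :> R.
Proof. by rewrite fine_ge0. Qed.

Lemma std_normal_cdf_le1 (w : R) : std_normal_cdf w <= 1 :> R.
Proof.
rewrite -[1]/(fine 1%E) fine_le ?fin_num_measure //.
exact: probability_le1.
Qed.

(** Under the normal law the identity is a random variable with distribution function [Phi]; the
    general limits at both infinities then apply. *)
Let idR : measurableTypeR R -> R := idfun.
#[local] HB.instance Definition _ :=
  @isMeasurableFun.Build _ _ _ _ idR (@measurable_id _ _ setT).

Let cdfE (w : R) : cdf (idR : {RV (normal_prob 0 1 : probability _ R) >-> R}) w
  = (Phi w)%:E.
Proof. by rewrite /Phi /std_normal_cdf fineK ?fin_num_measure. Qed.

Lemma cvg_std_normal_cdfy : std_normal_cdf w @[w --> +oo] --> (1 : R).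
Proof.
have := cvg_cdfy1 (idR : {RV (normal_prob 0 1 : probability _ R) >-> R}).
rewrite (_ : cdf _ = EFin \o Phi); last by apply/funext => w; exact: cdfE.
by move/fine_cvgP => [].
Qed.

Lemma cvg_std_normal_cdfNy : std_normal_cdf w @[w --> -oo] --> (0 : R).
Proof.
have := cvg_cdfNy0 (idR : {RV (normal_prob 0 1 : probability _ R) >-> R}).
rewrite (_ : cdf _ = EFin \o Phi); last by apply/funext => w; exact: cdfE.
by move/fine_cvgP => [].
Qed.

Lemma is_derive_normal_pdf01 (w : R) :
  is_derive w 1 (normal_pdf 0 1 : R -> R) (- w * normal_pdf 0 1 w).
Proof.
rewrite -/phi (_ : phi = fun w => normal_peak 1 * expR (- (w ^+ 2 / 2))); last first.
  by apply/funext => v; rewrite phiE.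
by apply: is_derive_eq; rewrite /GRing.scale /=; field.
Qed.

Lemma MVT_derive (F dF : R -> R) (a b : R) :
  (forall w : R, is_derive w 1 F (dF w)) ->
  a <= b -> exists2 c, a <= c <= b & F b - F a = dF c * (b - a).
Proof.
move=> FD ab; have [|c cab E] := @MVT_segment _ F dF a b ab (fun w _ => FD w).
  apply: continuous_subspaceT => w.
  apply: differentiable_continuous; apply/derivable1_diffP.
  exact: (@ex_derive _ _ _ _ _ _ _ (FD w)).
by exists c => //; move: cab; rewrite in_itv.
Qed.

(* Mills' inequalities: [b |-> phi b + w * Phi b] is monotone on each side of
   [w], its derivative being [(w - b) * phi b]. *)
Lemma mills_right (w : R) : w * (1 - std_normal_cdf w) <= normal_pdf 0 1 w.
Proof.
rewrite -/phi -/Phi.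
have : w * (Phi b - Phi w) @[b --> +oo] --> w * (1 - Phi w).
  apply: cvgMr; apply: cvgB; last exact: cvg_cst.
  exact: cvg_std_normal_cdfy.
move/cvgr_to_le; apply; near=> b.
have wb : w <= b by near: b; apply: nbhs_pinfty_ge; exact: num_real.
have FD (v : R) : is_derive v 1 (fun v => phi v + w * Phi v) ((w - v) * phi v).
  have h1 := is_derive_normal_pdf01 v; have h2 := is_derive_std_normal_cdf v.
  by apply: is_derive_eq; rewrite /GRing.scale /= -/phi; ring.
have [c /andP[wc cb] E] := MVT_derive FD wb.
have : (w - c) * phi c * (b - w) <= 0.
  by rewrite mulr_le0_ge0 ?subr_ge0 // mulr_le0_ge0 ?subr_le0 // ltW.
by rewrite -E; have := phi_gt0 b; lra.
Unshelve. all: by end_near. Qed.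

Lemma mills_left (w : R) : - w * std_normal_cdf w <= normal_pdf 0 1 w.
Proof.
rewrite -/phi -/Phi.
have : - w * (Phi w - Phi b) @[b --> -oo] --> - w * (Phi w - 0).
  apply: cvgMr; apply: cvgB; first exact: cvg_cst.
  exact: cvg_std_normal_cdfNy.
rewrite subr0 => /cvgr_to_le; apply; near=> b.
have bw : b <= w by near: b; apply: nbhs_ninfty_le; exact: num_real.
have FD (v : R) : is_derive v 1 (fun v => phi v + w * Phi v) ((w - v) * phi v).
  have h1 := is_derive_normal_pdf01 v; have h2 := is_derive_std_normal_cdf v.
  by apply: is_derive_eq; rewrite /GRing.scale /= -/phi; ring.
have [c /andP[wc cb] E] := MVT_derive FD bw.
have : 0 <= (w - c) * phi c * (w - b).
  by rewrite !mulr_ge0 ?subr_ge0 // ltW.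
by rewrite -E; have := phi_gt0 b; lra.
Unshelve. all: by end_near. Qed.

(** The derivative is bounded by [2]. The bound on [w * F w] is only asked on the interval, so that
    each branch of the solution can be treated on its own side of [x]. *)
Lemma stein_lipschitz (F : R -> R) (kappa a b : R) :
  (forall w : R, is_derive w 1 F (w * F w + kappa)) ->
  (forall w, a <= w <= b -> `|w * F w| <= 1) -> `|kappa| <= 1 -> a <= b ->
  `|F b - F a| <= 2 * (b - a).
Proof.
move=> FD Fb k1 ab; have [c cab ->] := MVT_derive FD ab.
rewrite normrM (ger0_norm (_ : 0 <= b - a)) ?subr_ge0 // ler_wpM2r ?subr_ge0 //.
by apply: le_trans (ler_normD _ _) _; have := Fb c cab; lra.
Qed.

(** At the mean value point [c], the derivative differs from that at [v] by
    [(c - v) * F c + v * (F c - F v)]; the first term is bounded through [C], the second by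
    [stein_lipschitz]. *)
Lemma stein_increment (F : R -> R) (kappa C a b v : R) :
  (forall w : R, is_derive w 1 F (w * F w + kappa)) ->
  (forall w, a <= w <= b -> `|F w| <= C) ->
  (forall w, a <= w <= b -> `|w * F w| <= 1) -> `|kappa| <= 1 ->
  a <= v <= b ->
  `|F b - F a - (v * F v + kappa) * (b - a)| <= (C + 2 * `|v|) * (b - a) ^+ 2.
Proof.
move=> FD FC Fb k1 /andP[av vb]; have ab := le_trans av vb.
have [c /andP[ac cb] ->] := MVT_derive FD ab.
have ba0 : 0 <= b - a by rewrite subr_ge0.
rewrite -mulrBl normrM (ger0_norm ba0) expr2 mulrA ler_wpM2r //.
have -> : c * F c + kappa - (v * F v + kappa) = (c - v) * F c + v * (F c - F v) by ring.
apply: le_trans (ler_normD _ _) _; rewrite !normrM mulrDl.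
have cv : `|c - v| <= b - a by rewrite ler_norml; apply/andP; split; lra.
have Fcv : `|F c - F v| <= 2 * (b - a).
  have [cv'|vc] := leP c v.
    rewrite distrC; apply: le_trans (stein_lipschitz FD _ k1 cv') _; last lra.
    by move=> w /andP[cw wv]; apply: Fb; rewrite (le_trans ac) ?(le_trans wv).
  apply: le_trans (stein_lipschitz FD _ k1 (ltW vc)) _; last lra.
  by move=> w /andP[vw wc]; apply: Fb; rewrite (le_trans av) ?(le_trans wc).
apply: lerD.
  by rewrite mulrC; apply: ler_pM => //; apply: FC; rewrite ac.
by rewrite [2 * _]mulrC -mulrA ler_wpM2l.
Qed.

Variable x : R.

(** Integrating factor of Stein's equation: a solution of [f' w = w * f w]. *)
Let ig (w : R) : R := (phi w)^-1.

Let ig_gt0 w : 0 < ig w.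
Proof. by rewrite invr_gt0. Qed.

Let is_derive_ig (w : R) : is_derive w 1 ig (w * ig w).
Proof.
have h1 := is_derive_normal_pdf01 w; have phi0 : phi w != 0 by rewrite gt_eqF.
by rewrite /ig; apply: is_derive_eq; rewrite /GRing.scale /= -/phi; field.
Qed.

Let phi_ig w : phi w * ig w = 1.
Proof. by rewrite divff // gt_eqF. Qed.

(** The two branches of the bounded solution, left and right of [x]. Each is differentiable on the
    whole line, and they agree at [x]. *)
Let fl (w : R) : R := Phi w * (1 - Phi x) * ig w.
Let fr (w : R) : R := Phi x * (1 - Phi w) * ig w.

Let fl_derive (w : R) : is_derive w 1 fl (w * fl w + (1 - Phi x)).
Proof.
have h1 := is_derive_ig w; have h2 := is_derive_std_normal_cdf w.
apply: is_derive_eq; rewrite /GRing.scale /= -/phi -/Phi /fl.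
by rewrite -[X in _ = _ + X]mul1r -(phi_ig w); ring.
Qed.

Let fr_derive (w : R) : is_derive w 1 fr (w * fr w - Phi x).
Proof.
have h1 := is_derive_ig w; have h2 := is_derive_std_normal_cdf w.
apply: is_derive_eq; rewrite /GRing.scale /= -/phi -/Phi /fr.
rewrite -[X in _ = _ - X]mulr1 -[X in _ - _ * X](phi_ig w). ring.
Qed.

Let Phi_homo (a b : R) : a <= b -> Phi a <= Phi b.
Proof.
move=> ab; have [c _ E] := MVT_derive is_derive_std_normal_cdf ab.
by rewrite -subr_ge0 E mulr_ge0 ?subr_ge0 // ltW.
Qed.

Let P0 w : 0 <= Phi w. Proof. exact: std_normal_cdf_ge0. Qed.
Let Q0 w : 0 <= 1 - Phi w. Proof. by rewrite subr_ge0 std_normal_cdf_le1. Qed.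
Let Q1 w : 1 - Phi w <= 1. Proof. by rewrite gerBl. Qed.
Let P1 w : Phi w <= 1. Proof. exact: std_normal_cdf_le1. Qed.

(** After multiplication by [phi w] this is a Mills inequality: for [w >= 0] use
    [1 - Phi x <= 1 - Phi w], for [w < 0] use [1 - Phi x <= 1]. *)
Let xfl_le1 w : w <= x -> `|w * fl w| <= 1.
Proof.
move=> wx; rewrite normrM (ger0_norm (_ : 0 <= fl w)); last first.
  by rewrite !mulr_ge0 // ltW.
rewrite -(phi_ig w) /fl mulrA ler_pM2r //.
have [w0|w0] := leP 0 w.
  rewrite ger0_norm //; apply: le_trans (mills_right w); rewrite ler_wpM2l //.
  by rewrite -[leRHS]mul1r ler_pM // lerD2l lerN2; exact: Phi_homo.
rewrite ltr0_norm //; apply: le_trans (mills_left w).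
rewrite ler_wpM2l ?oppr_ge0 ?(ltW w0) //.
by rewrite ler_piMr.
Qed.

Let xfr_le1 w : x <= w -> `|w * fr w| <= 1.
Proof.
move=> xw; rewrite normrM (ger0_norm (_ : 0 <= fr w)); last first.
  by rewrite !mulr_ge0 // ltW.
rewrite -(phi_ig w) /fr mulrA ler_pM2r //.
have [w0|w0] := leP 0 w.
  rewrite ger0_norm //; apply: le_trans (mills_right w); rewrite ler_wpM2l //.
  by rewrite ler_piMl.
rewrite ltr0_norm //; apply: le_trans (mills_left w).
rewrite ler_wpM2l ?oppr_ge0 ?(ltW w0) //.
by rewrite -[leRHS]mulr1 ler_pM //; exact: Phi_homo.
Qed.

(** Bounds both branches, each on its side of [x], independently of [x]: for [|w| > 1] the bound on
    [w * f w] gives [1], and for [|w| <= 1] the branch is at most [ig w <= ig 1]. *)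
Definition stein_bound : R := 1 + ig 1.

Lemma stein_bound_ge0 : 0 <= stein_bound.
Proof. by rewrite addr_ge0 // ltW. Qed.

Let ig_le w : `|w| <= 1 -> ig w <= ig 1.
Proof.
move=> w1; rewrite lef_pV2 ?posrE // !phiE ler_pM2l ?normal_peak_gt0 ?oner_eq0 //.
rewrite ler_expR lerN2 ler_pM2r ?invr_gt0 // expr1n -real_normK ?num_real //.
by rewrite exprn_ile1.
Qed.

Let le_stein_bound F w : 0 <= F -> `|w * F| <= 1 -> F <= ig w -> `|F| <= stein_bound.
Proof.
move=> F0 wF Fi; rewrite ger0_norm //.
have [/ig_le w1|w1] := leP `|w| 1.
  by apply: le_trans Fi (le_trans w1 _); rewrite lerDr.
apply: le_trans (_ : 1 <= _); last by rewrite lerDl ltW.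
by apply: le_trans wF; rewrite normrM (ger0_norm F0) ler_peMl // ltW.
Qed.

Let fl_le w : w <= x -> `|fl w| <= stein_bound.
Proof.
move=> wx; apply: (@le_stein_bound _ w); last first.
- by rewrite /fl ler_piMl ?(ltW (ig_gt0 _)) // mulr_ile1.
- exact: xfl_le1.
- by rewrite !mulr_ge0 // ltW.
Qed.

Let fr_le w : x <= w -> `|fr w| <= stein_bound.
Proof.
move=> wx; apply: (@le_stein_bound _ w); last first.
- by rewrite /fr ler_piMl ?(ltW (ig_gt0 _)) // mulr_ile1.
- exact: xfr_le1.
- by rewrite !mulr_ge0 // ltW.
Qed.

(* Solves Stein's equation [f' w = stein_defect w], except at [w = x]. *)
Definition stein_solution (w : R) : R := if w <= x then fl w else fr w.

Definition stein_defect (w : R) : R :=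
  w * stein_solution w + ((w <= x)%R%:R - std_normal_cdf x).

(** If [x] does not separate [a] from [b], a single branch is involved and [stein_increment]
    applies. Otherwise the quotient and the defect are each at most [2], and this cost is charged to
    the indicator. *)
Lemma stein_solution_step (a b v : R) : a < b -> (v == a) || (v == b) ->
  `|(stein_solution b - stein_solution a) / (b - a) - stein_defect v|
  <= (stein_bound + 2 * `|v|) * (b - a) + 4 * (`|v - x| <= b - a)%R%:R.
Proof.
move=> ab vab; have ba : 0 < b - a by rewrite subr_gt0.
have v_itv : a <= v <= b by case/orP: vab => /eqP ->; rewrite lexx (ltW ab).
have /andP[av vb] := v_itv.
have C0 := stein_bound_ge0.
have kl : `|1 - Phi x| <= 1 by rewrite ger0_norm.
have kr : `|- Phi x| <= 1 by rewrite normrN ger0_norm.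
have tail : 0 <= 4 * (`|v - x| <= b - a)%R%:R :> R by rewrite mulr_ge0.
have scale (X d : R) :
    `|X - d * (b - a)| <= (stein_bound + 2 * `|v|) * (b - a) ^+ 2 ->
    `|X / (b - a) - d| <= (stein_bound + 2 * `|v|) * (b - a).
  move=> h; have -> : X / (b - a) - d = (X - d * (b - a)) / (b - a).
    by field; rewrite gt_eqF.
  by rewrite normrM normfV (gtr0_norm ba) ler_pdivrMr // -mulrA -expr2.
have [bx|xb] := leP b x.
  rewrite /stein_defect /stein_solution bx (le_trans (ltW ab) bx) (le_trans vb bx).
  rewrite -[leLHS]addr0 lerD //; apply: scale.
  apply: (stein_increment fl_derive) => // w /andP[_ wb].
    by apply: fl_le; exact: le_trans bx.
  by apply: xfl_le1; exact: le_trans bx.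
have [ax|xa] := leP a x; last first.
  have xv := lt_le_trans xa av.
  rewrite /stein_defect /stein_solution [a <= x]leNgt [b <= x]leNgt [v <= x]leNgt.
  rewrite xa xb xv /= add0r.
  rewrite -[leLHS]addr0 lerD //; apply: scale.
  apply: (stein_increment fr_derive) => // w /andP[aw _].
    by apply: fr_le; apply: le_trans aw; exact: ltW.
  by apply: xfr_le1; apply: le_trans aw; exact: ltW.
have -> : `|v - x| <= b - a by rewrite ler_norml; apply/andP; split; lra.
rewrite mulr1; apply: (@le_trans _ _ 4); last first.
  by rewrite lerDr mulr_ge0 ?(ltW ba) // addr_ge0 // mulr_ge0.
have inc : `|(stein_solution b - stein_solution a) / (b - a)| <= 2.
  rewrite normrM normfV (gtr0_norm ba) ler_pdivrMr // /stein_solution.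
  rewrite [b <= x]leNgt xb ax /=.
  (* Continuity at the kink: [fr x = fl x]. *)
  have -> : fr b - fl a = (fr b - fr x) + (fl x - fl a) by rewrite /fl /fr; ring.
  apply: le_trans (ler_normD _ _) _.
  have h1 : `|fr b - fr x| <= 2 * (b - x).
    apply: (stein_lipschitz fr_derive) => //; last exact: ltW.
    by move=> w /andP[xw _]; exact: xfr_le1.
  have h2 : `|fl x - fl a| <= 2 * (x - a).
    apply: (stein_lipschitz fl_derive) => //.
    by move=> w /andP[_ wx]; exact: xfl_le1.
  by lra.
have def : `|stein_defect v| <= 2.
  apply: le_trans (ler_normD _ _) _; rewrite -[leRHS]/(1 + 1) lerD //.
    rewrite /stein_solution; case: (leP v x) => vx; first exact: xfl_le1.
    by apply: xfr_le1; exact: ltW.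
  by case: (v <= x); rewrite ?sub0r.
apply: le_trans (ler_normB _ _) _; lra.
Qed.

End NormalCdf.

(** * Normal approximation of Bernoulli sums *)

Section NormalApproximation.
Variables (R : realType) (s : seq R) (delta : R).
Hypothesis sP : probs s.
Hypothesis pb_le : forall k : nat, pb s (fun j => (j == k)%:R) <= delta.

Let mu := pb_mean s.
Let V := pb_var s.

(** Such a window contains at most [l.+1] integers, counted from the least one, each of mass at most
    [delta]. *)
Lemma pb_window (a : R) (l : nat) :
  pb s (fun k => (a <= k%:R <= a + l%:R)%R%:R) <= l.+1%:R * delta.
Proof.
have delta0 : 0 <= delta.
  by apply: le_trans (pb_le 0); rewrite -[leLHS](pb_cst s); apply: ler_pb.
have [exk|nok] := pselect (exists k : nat, a <= k%:R <= a + l%:R); last first.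
  apply: (@le_trans _ _ (pb s (fun=> 0))); last by rewrite pb_cst mulr_ge0.
  apply: ler_pb => // k; have [kP|//] := boolP (a <= k%:R <= a + l%:R).
  by case: nok; exists k.
have [k0 k0P k0min] := ex_minnP exk.
rewrite (_ : _ * delta = \sum_(j < l.+1) delta); last first.
  by rewrite sumr_const card_ord mulr_natl.
apply: (@le_trans _ _ (\sum_(j < l.+1) pb s (fun k => (k == k0 + j)%N%:R))); last first.
  by apply: ler_sum => j _; exact: pb_le.
rewrite -pb_sum; apply: ler_pb => // k.
have [kP|_] := boolP (a <= k%:R <= a + l%:R); last by rewrite sumr_ge0.
have k0k := k0min k kP.
have kl : (k - k0 < l.+1)%N.
  rewrite ltnS -(ler_nat R) natrB //.
  by move: kP k0P => /andP[_ k2] /andP[k1 _]; lra.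
by rewrite (bigD1 (Ordinal kl)) //= subnKC // eqxx lerDl sumr_ge0.
Qed.

(** At least half of the mass lies outside a window around the mean, hence at distance at least [h]
    from it. *)
Lemma pb_var_ge (h : nat) : (2 * h).+1%:R * delta <= 1 / 2 -> h%:R ^+ 2 / 2 <= V.
Proof.
move=> small; rewrite /V -pb_variance -/mu.
pose I k : R := (mu - h%:R <= k%:R <= mu - h%:R + (2 * h)%N%:R)%R%:R.
apply: (@le_trans _ _ (pb s (fun k => h%:R ^+ 2 * (1 - I k)))).
  rewrite pbZ pbB pb_cst ler_wpM2l ?sqr_ge0 //.
  have := le_trans (pb_window (mu - h%:R) (2 * h)) small.
  by rewrite -/I; lra.
apply: ler_pb => // k; rewrite /I natrM.
have [_|] := boolP (mu - h%:R <= k%:R <= _); first by rewrite subrr mulr0 sqr_ge0.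
rewrite subr0 mulr1 => kI; rewrite -[leRHS]real_normK ?num_real //.
rewrite lerXn2r ?nnegrE //; rewrite leNgt; apply: contra kI.
by rewrite ltr_norml => /andP[k1 k2]; apply/andP; split; lra.
Qed.

Hypothesis V0 : 0 < V.
Let sigma := Num.sqrt V.

(** Stein's identity for [stein_solution] on the lattice of mesh [1 / sigma]. The defect minus
    [w * g] is the indicator minus [std_normal_cdf x], and [stein_solution_step] controls the
    discretization error at both ends of each step. *)
Lemma pb_normal_approx (x : R) :
  `|pb s (fun k => ((k%:R - mu) / sigma <= x)%R%:R) - std_normal_cdf x|
  <= (stein_bound R + 2) / sigma + 12 * delta.
Proof.
have sigma0 : 0 < sigma by rewrite sqrtr_gt0.
have sigma2 : sigma ^+ 2 = V by rewrite sqr_sqrtr // ltW.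
pose h := sigma^-1; have h0 : 0 < h by rewrite invr_gt0.
have h0' := ltW h0.
pose w k : R := (k%:R - mu) / sigma.
pose g k := stein_solution x (w k).
pose Z k := (stein_bound R + 2 * `|w k|) * h + 4 * (`|w k - x| <= h)%R%:R.
have wS k : w k.+1 - w k = h.
  by rewrite /w /h -mulrBl -natr1; field; rewrite gt_eqF.
have w_inj : injective w.
  move=> a b /(congr1 ( *%R^~ sigma)); rewrite /w !divfK ?gt_eqF //.
  by move=> /addIr/eqP; rewrite eqr_nat => /eqP.
have step j k : (j == k) || (j == k.+1) ->
    `|(g k.+1 - g k) - h * stein_defect x (w j)| <= h * Z j.
  move=> jk; have wk : w k < w k.+1 by rewrite -subr_gt0 wS.
  have := @stein_solution_step R x (w k) (w k.+1) (w j) wk.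
  rewrite !(inj_eq w_inj) => /(_ jk); rewrite wS -/(g k) -/(g k.+1) => le.
  have -> : g k.+1 - g k - h * stein_defect x (w j)
     = h * ((g k.+1 - g k) / h - stein_defect x (w j)).
    by field; rewrite gt_eqF.
  by rewrite normrM (gtr0_norm h0) ler_wpM2l.
have stepl k : `|(g k.+1 - g k) - h * stein_defect x (w k)| <= h * Z k.
  by apply: step; rewrite eqxx.
have stepr k : `|(g k.+1 - g k) - h * stein_defect x (w k.+1)| <= h * Z k.+1.
  by apply: step; rewrite eqxx orbT.
have := @pb_stein_approx R s (fun k => g k.+1 - g k)
  (fun k => h * stein_defect x (w k)) (fun k => h * Z k) sP stepl stepr.
rewrite -pb_stein_identity !pbZ -/V.
have -> : pb s (fun k => (k%:R - pb_mean s) * g k) = V * (h * pb s (fun k => w k * g k)).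
  rewrite mulrA -pbZ; apply: eq_pb => k; rewrite /w -sigma2 /h -/mu.
  by field; rewrite gt_eqF.
rewrite -mulrBr -mulrBr normrM (gtr0_norm V0) ler_pM2l //.
rewrite normrM (gtr0_norm h0) ler_pM2l // -pbB.
have -> : pb s (fun k => w k * g k - stein_defect x (w k))
  = - (pb s (fun k => (w k <= x)%R%:R) - std_normal_cdf x).
  rewrite -[std_normal_cdf x](pb_cst s) -pbB -pbN; apply: eq_pb => k.
  by rewrite /stein_defect /g; ring.
rewrite normrN => /le_trans; apply.
rewrite /Z pbD pbZ.
have -> : pb s (fun k => (stein_bound R + 2 * `|w k|) * h)
  = (stein_bound R + 2 * pb s (fun k => `|w k|)) * h.
  rewrite mulrC -[X in X + _](pb_cst s) -pbZ -pbD -pbZ.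
  by apply: eq_pb => k; rewrite mulrC.
apply: lerD.
  rewrite ler_wpM2r // lerD2l -[leRHS]mulr1 ler_wpM2l //.
  (* The standardized variable has second moment [1], so its first absolute moment is at most
     [1]. *)
  apply: (@le_trans _ _ (pb s (fun k => 2^-1 * (1 + w k ^+ 2)))).
    apply: ler_pb => // k; have := sqr_ge0 (`|w k| - 1).
    by rewrite sqrrB real_normK ?num_real //; lra.
  rewrite pbZ pbD pb_cst.
  have -> : pb s (fun k => w k ^+ 2) = 1; last by lra.
  rewrite (@eq_pb _ _ _ (fun k => V^-1 * (k%:R - mu) ^+ 2)).
    by rewrite pbZ pb_variance mulVf // gt_eqF.
  by move=> k; rewrite /w exprMn exprVn sigma2 mulrC.
(* The kink is met only within distance [1] of [mu + sigma * x]: at most three integers. *)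
rewrite (_ : 12 = 4 * 3); last by ring.
rewrite -mulrA ler_wpM2l //.
apply: le_trans (pb_window (mu + sigma * x - 1) 2); apply: ler_pb => // k.
have [wk|_] := boolP (`|w k - x| <= h); last by rewrite ler_nat.
have -> // : mu + sigma * x - 1 <= k%:R <= mu + sigma * x - 1 + 2.
have kE : k%:R = mu + sigma * x + sigma * (w k - x).
  by rewrite /w; field; rewrite gt_eqF.
have : `|sigma * (w k - x)| <= 1.
  by rewrite normrM (gtr0_norm sigma0) mulrC -ler_pdivlMr // mul1r.
by rewrite ler_norml kE => /andP[k1 k2]; apply/andP; split; lra.
Qed.

End NormalApproximation.

(** * Laws on the integers *)

Lemma mnormalizeE d (X : measurableType d) (R : realType)
    (m : {measure set X -> \bar R}) (P : probability X R) (T : R) :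
  m [set: X] = T%:E -> 0 < T ->
  forall A, mnormalize m P A = (m A * (T^-1)%:E)%E.
Proof. by move=> mT T0 A; rewrite /mnormalize mT eqe gt_eqF. Qed.

Section PoissonBinomialLaw.
Variables (R : realType) (a : int -> {nonneg R}) (s : seq R) (N : nat) (T : R).
Hypothesis T0 : 0 < T.
Hypothesis a_neg : forall n, (a (Negz n))%:num = 0.
Hypothesis a_large : forall k : nat, (N <= k)%N -> (a k%:Z)%:num = 0.
Hypothesis a_pb : forall g : nat -> R,
  \sum_(k < N) (a k%:Z)%:num * g k = T * pb s g.

Lemma weight_measure_sum (A : set int) :
  weight_measure a A = (\sum_(k < N) ((a k%:Z)%:num * \1_A k%:Z)%:E)%E.
Proof.
rewrite /weight_measure esum_mkcond.
pose S : set int := Posz @` `I_N.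
pose b (i : int) : \bar R := if i \in A then ((a i)%:num)%:E else 0%E.
have -> : (\esum_(i in [set: int]) b i = \esum_(i in S) b i)%E.
  rewrite [RHS]esum_mkcond; apply: eq_esum => i _; case: ifPn => // iS.
  rewrite /b; case: ifP => // _; case: i iS => [k|n] iS; last by rewrite a_neg.
  rewrite a_large // leqNgt; apply: contra iS => kN.
  by rewrite inE; exists k.
rewrite esum_image; last by move=> i j _ _ [].
rewrite esum_fset; last 2 first.
- exact: finite_II.
- by move=> i _; rewrite /b; case: ifP => // _; rewrite lee_fin.
rewrite -fsbig_ord; apply: eq_bigr => k _; rewrite /b indicE.
by case: (_ \in A); rewrite ?mulr1 ?mulr0.
Qed.

Lemma weight_measureE (A : set int) :
  weight_measure a A = (T * pb s (fun k => \1_A k%:Z))%:E.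
Proof. by rewrite weight_measure_sum sumEFin -a_pb. Qed.

Lemma weight_total : (\esum_(k in [set: int]) ((a k)%:num)%:E)%E = T%:E.
Proof.
rewrite -/(weight_measure a setT) weight_measureE.
rewrite (@eq_pb _ _ _ (fun=> 1)) ?pb_cst ?mulr1 // => k.
by rewrite indicE in_setT.
Qed.

Lemma lawE (A : set int) : law a A = (pb s (fun k => \1_A k%:Z))%:E.
Proof.
have -> : law a A = (weight_measure a A * (T^-1)%:E)%E.
  exact: (mnormalizeE (m := weight_measure a) (dirac (0 : int)) weight_total T0 A).
rewrite weight_measureE.
by rewrite -EFinM mulrAC mulfV ?mul1r // gt_eqF.
Qed.

Let T_neq0 : T != 0.
Proof. by rewrite gt_eqF. Qed.

Let c_ge0 (k : nat) : 0 <= (a k%:Z)%:num / T.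
Proof. by rewrite divr_ge0 // ltW. Qed.

Let c (k : nat) : {nonneg R} := NngNum (c_ge0 k).

(** By [lawE] the law is the finite mixture of the Dirac measures at [k < N] with weights
    [a k / T]. *)
Lemma integral_law_ge0 (f : int -> R) : (forall k, 0 <= f k) ->
  (\int[law a]_k (f k)%:E = (pb s (fun k => f k%:Z))%:E)%E.
Proof.
move=> f0.
pose m (k : nat) : {measure set int -> \bar R} :=
  mscale (c k) (dirac (k%:Z : int)).
have mf : measurable_fun [set: int] (fun k : int => (f k)%:E) by [].
rewrite (@eq_measure_integral _ _ _ _ (msum m N)); last first.
  move=> A _ _; apply: (etrans (lawE A)).
  rewrite /msum /= -[pb s _](mulKf T_neq0).
  rewrite -a_pb mulr_sumr -sumEFin; apply: eq_bigr => k _.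
  rewrite /m /= /mscale /= diracE -EFinM indicE; congr EFin; ring.
rewrite ge0_integral_measure_sum //; last by move=> k _; rewrite lee_fin.
rewrite -[pb s _](mulKf T_neq0) -a_pb mulr_sumr -sumEFin.
apply: eq_bigr => k _; rewrite ge0_integral_mscale //; last first.
  by move=> i _; rewrite lee_fin.
rewrite integral_dirac // diracT mul1e -EFinM; congr EFin => /=; ring.
Qed.

Lemma integral_law (f : int -> R) :
  (\int[law a]_k (f k)%:E = (pb s (fun k => f k%:Z))%:E)%E.
Proof.
rewrite integralE.
have -> : ((fun k => (f k)%:E)^\+ = fun k => (Num.max (f k) 0)%:E)%E.
  by apply/funext => k; rewrite funepos.unlock /= EFin_max.
have -> : ((fun k => (f k)%:E)^\- = fun k => (Num.max (- f k) 0)%:E)%E.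
  by apply/funext => k; rewrite funeneg.unlock /= EFin_max.
rewrite !integral_law_ge0; last 2 first.
- by move=> k; rewrite le_max lexx orbT.
- by move=> k; rewrite le_max lexx orbT.
rewrite -EFinB -pbB; congr EFin; apply: eq_pb => k.
have /orP[fk|fk] := le_total 0 (f k%:Z).
  by rewrite max_l // max_r ?oppr_le0 // subr0.
by rewrite max_r // max_l ?oppr_ge0 // opprK add0r.
Qed.

Lemma mean_law : mean a = pb_mean s.
Proof. by rewrite /mean expectation.unlock integral_law -pb_id. Qed.

Lemma stddev_law : stddev a = Num.sqrt (pb_var s).
Proof.
have fine_mean : fine 'E_(law a)[int_rv] = pb_mean s by exact: mean_law.
rewrite /stddev /variance covariance.unlock fine_mean expectation.unlock.
by rewrite integral_law /= -pb_variance.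
Qed.

Lemma standardized_cdf_law (x : R) : standardized_cdf a x =
  pb s (fun k => ((k%:R - pb_mean s) / Num.sqrt (pb_var s) <= x)%R%:R).
Proof.
rewrite /standardized_cdf lawE mean_law stddev_law /=; apply: eq_pb => k.
by rewrite indicE; congr ((nat_of_bool _)%:R); apply/idP/idP; rewrite inE.
Qed.

Lemma Lfun_law : int_rv \in Lfun (law a) 2%:E.
Proof.
rewrite inE; apply/andP; split; first by rewrite inE.
rewrite inE /= /finite_norm unlock; apply: poweR_lty.
rewrite (eq_integral (fun k : int => (`|int_rv k| `^ 2)%:E)) => [|k _].
  by rewrite integral_law ltry.
by rewrite -poweR_EFin.
Qed.

End PoissonBinomialLaw.

(** * Asymptotic normality of the Stirling sequence *)

Lemma stirling_poisson_binomial (R : realType) (G : sgraph) :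
  quasi_threshold G \/ (exists2 H : sgraph, quasi_threshold H & cochromatic G H) ->
  exists (s : seq R) (N : nat) (T : R), [/\ probs s, 0 < T,
    forall k : nat, (N <= k)%N -> graph_stirling G k%:Z = 0%N,
    forall g : nat -> R,
      \sum_(k < N) (graph_stirling G k%:Z)%:R * g k = T * pb s g &
    forall J : nat, (0 < J)%N ->
      (2 * (32 * J ^ 4 * (32 * J ^ 4 + chromatic_number G))
       + chromatic_number G < #|G|)%N ->
      forall k : nat, pb s (fun j => (j == k)%:R) <= 8 / J%:R].
Proof.
move=> /num_colorings_determine[es [card_es es_chi numE]].
have [rs [szrs rs0 stirE]] := graph_stirling_real_rooted R es_chi numE.
pose N := maxn (size rs).+1 #|{set G}|.+1.
have a_large k : (N <= k)%N -> graph_stirling G k%:Z = 0%N.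
  by rewrite geq_max => /andP[_]; exact: graph_stirling_large.
pose T : R := \prod_(r <- rs) (1 + r).
pose s := [seq (1 + r)^-1 | r <- rs].
have T0 : 0 < T.
  by rewrite /T big_seq prodr_gt0 // => r /(allP rs0) r0; rewrite ltr_pwDl.
have sP : probs s.
  rewrite /probs all_map; apply: sub_all rs0 => r /= r0.
  by rewrite invr_ge0 addr_ge0 //= invf_le1 ?lerDl // ltr_pwDl.
have a_pb (g : nat -> R) :
    \sum_(k < N) (graph_stirling G k%:Z)%:R * g k = T * pb s g.
  rewrite -(@pb_polyE _ rs g N) //; last by rewrite leq_max leqnn.
  by apply: eq_bigr => k _; rewrite stirE.
exists s, N, T; split=> // J J0 big_G k.
have big_es : (2 * (32 * J ^ 4 * (32 * J ^ 4 + chromatic_number G)) < size es)%N.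
  by move: big_G; rewrite -card_es; lia.
have := graph_stirling_concentration R es_chi numE J0 big_es k.
have -> : \sum_(i < #|{set G}|.+1) (graph_stirling G i%:Z)%:R = T :> R.
  have := a_pb (fun=> 1); rewrite pb_cst mulr1 => <-.
  rewrite (big_ord_widen N (fun i => (graph_stirling G i%:Z)%:R)) ?leq_maxr //.
  rewrite big_mkcond; apply: eq_bigr => i _; rewrite mulr1; case: ltnP => // li.
  by rewrite graph_stirling_large.
have : T * pb s (fun j => (j == k)%:R) <= (graph_stirling G k%:Z)%:R.
  rewrite -a_pb; have [kN|Nk] := ltnP k N.
    rewrite (bigD1 (Ordinal kN)) //= eqxx mulr1 big1 ?addr0 // => j jk.
    by rewrite -val_eqE /= in jk; rewrite (negbTE jk) mulr0.
  rewrite big1 // => j _; rewrite ltn_eqF ?mulr0 //.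
  exact: leq_trans (ltn_ord j) Nk.
have J0' : 0 < J%:R :> R by rewrite ltr0n.
move=> h1 h2; rewrite ler_pdivlMr // -(ler_pM2l T0) mulrA.
by rewrite [leRHS]mulrC; apply: le_trans h2; rewrite mulrC ler_wpM2l.
Qed.

Theorem theorem2 (R : realType) (G : nat -> sgraph)
    (hG : forall n, quasi_threshold (G n) \/
            exists2 H : sgraph, quasi_threshold H & cochromatic (G n) H)
    (hf : #|G n| @[n --> \oo] --> \oo)
    (hg : ((chromatic_number (G n))%:R / #|G n|%:R : R) @[n --> \oo]
            --> (0 : R)) :
  asymptotically_normal (fun n => stirling_sequence R (G n)).
Proof.
have neg n k : (stirling_sequence R (G n) (Negz k))%:num = 0.
  by rewrite /= graph_stirling_neg.
split=> [n|n|].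
- have [s [N [T [sP T0 a_large a_pb _]]]] := stirling_poisson_binomial R (hG n).
  rewrite (@weight_total _ _ s N T) //; first by rewrite lte_fin T0 ltry.
  by move=> k Nk; rewrite /= a_large.
- have [s [N [T [sP T0 a_large a_pb _]]]] := stirling_poisson_binomial R (hG n).
  apply: (@Lfun_law _ _ s N T) => //.
  by move=> k Nk; rewrite /= a_large.
move=> P /uniform_nbhs[E [entE EP]].
move: entE; rewrite -entourage_ballE => -[e /= e0 ballE].
(* With [sigma >= h / 2] and [delta = 8 / J], the two error terms are at most
   [2 * (stein_bound R + 2) / h] and [96 / J <= 3 / h]. *)
pose C := 2 * (stein_bound R + 2) + 3 : R.
have [h h0 hC] : exists2 h : nat, (0 < h)%N & C / h%:R < e.
  exists (Num.truncn (C / e)).+1 => //.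
  by rewrite ltr_pdivrMr ?ltr0n // mulrC -ltr_pdivrMr // truncnS_gt.
(* [J = 16 * (2 * h + 1)] makes [(2 * h).+1 * (8 / J)] equal to [1 / 2], as [pb_var_ge] requires. *)
pose J := (32 * h + 16)%N.
have J0 : (0 < J)%N by rewrite addn_gt0 orbT.
pose K := (32 * J ^ 4)%N.
have big_G : \forall n \near \oo,
    (2 * (K * (K + chromatic_number (G n))) + chromatic_number (G n) < #|G n|)%N.
  (* The left-hand side is [2 * K ^ 2 + (2 * K + 1) * chi]; each summand is made smaller than half
     the number of vertices. *)
  have f_large : \forall n \near \oo, (4 * K ^ 2 < #|G n|)%N.
    exact: (hf _ (nbhs_infty_gt _)).
  have c0 : 0 < (2 * (2 * K + 1))%:R^-1 :> R.
    by rewrite invr_gt0 ltr0n muln_gt0 addn_gt0 orbT.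
  have /cvgr_lt /(_ _ c0) g_small := hg.
  near=> n.
  have fn : (4 * K ^ 2 < #|G n|)%N by near: n.
  have : (chromatic_number (G n))%:R / #|G n|%:R < (2 * (2 * K + 1))%:R^-1 :> R.
    by near: n.
  have f0 : 0 < #|G n|%:R :> R by rewrite ltr0n; apply: leq_ltn_trans fn.
  rewrite ltr_pdivrMr // mulrC ltr_pdivlMr; last first.
    by rewrite ltr0n muln_gt0 addn_gt0 orbT.
  by rewrite -natrM ltr_nat => gn; nia.
near=> n; apply: EP => x _; apply: ballE.
have big_Gn : (2 * (K * (K + chromatic_number (G n))) + chromatic_number (G n)
    < #|G n|)%N by near: n.
have [s [N [T [sP T0 a_large a_pb conc]]]] := stirling_poisson_binomial R (hG n).
have pb_le := conc J J0 big_Gn.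
rewrite /ball /= (@standardized_cdf_law _ _ s N T) //; last first.
  by move=> k Nk; rewrite /= a_large.
have h0' : 0 < h%:R :> R by rewrite ltr0n.
have J_eq : J%:R = 32 * h%:R + 16 :> R by rewrite /J natrD natrM.
have J0' : 0 < J%:R :> R by rewrite ltr0n.
have V_ge : h%:R ^+ 2 / 2 <= pb_var s.
  apply: (pb_var_ge sP pb_le).
  rewrite mulrA ler_pdivrMr // J_eq -natr1 natrM; lra.
have V0 : 0 < pb_var s.
  by apply: lt_le_trans V_ge; rewrite divr_gt0 // exprn_gt0.
have sigma_ge : h%:R / 2 <= Num.sqrt (pb_var s).
  rewrite -[leLHS]ger0_norm ?divr_ge0 // -sqrtr_sqr ler_wsqrtr //.
  by apply: le_trans V_ge; rewrite expr_div_n ler_wpM2l ?sqr_ge0 // lef_pV2 ?posrE; lra.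
rewrite distrC; apply: le_lt_trans (pb_normal_approx sP pb_le V0 x) _.
apply: le_lt_trans hC; rewrite /C [leRHS]mulrDl; apply: lerD.
  rewrite [2 * _]mulrC -mulrA ler_wpM2l ?(addr_ge0 (stein_bound_ge0 R)) //.
  rewrite ler_pdivlMr // mulrC ler_pdivrMr ?sqrtr_gt0 //.
  by move: sigma_ge; lra.
by rewrite mulrA ler_pdivrMr // mulrAC ler_pdivlMr // J_eq; lra.
Unshelve. all: by end_near. Qed.
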